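(* Let $S$ be a nonempty set and $G$ a group of permutations of $S$. Then the twisted Brin–Thompson group $SV_G$ is simple. Moreover, if $SV_G$ is finitely generated, then it can be generated by two elements of finite order.
   Context: Let $\mathfrak C=\{0,1\}^{\omega}$ be the Cantor set, $S$ a nonempty set, and $G$ a subgroup of the symmetric group of $S$. Let $\mathfrak C^S$ be the space of all functions $S\to\mathfrak C$ with the product topology. For a function $\psi\colon S\to\{0,1\}^*$ with $\psi(s)=\varnothing$ for all but finitely many $s$, the dyadic brick $B(\psi)$ is the set of $\kappa\in\mathfrak C^S$ such that $\psi(s)$ is a prefix of $\kappa(s)$ for all $s\in S$; the canonical homeomorphism $\Phi_\psi\colon\mathfrak C^S\to B(\psi)$ is $\Phi_\psi(\kappa)(s)=\psi(s)\cdot\kappa(s)$. For $\gamma\in G$ let $\tau_\gamma(\kappa)(s)=\kappa(\gamma^{-1}s)$. The twist homeomorphism $B(\varphi)\to B(\psi)$ associated to $\gamma$ is $\Phi_\psi\circ\tau_\gamma\circ\Phi_\varphi^{-1}$. The twisted Brin–Thompson group $SV_G$ is the group of all homeomorphisms $h$ of $\mathfrak C^S$ for which there exist two partitions $B(\varphi_1),\dots,B(\varphi_n)$ and $B(\psi_1),\dots,B(\psi_n)$ of $\mathfrak C^S$ into dyadic bricks and $\gamma_1,\dots,\gamma_n\in G$ such that $h|_{B(\varphi_i)}$ is the twist homeomorphism $B(\varphi_i)\to B(\psi_i)$ associated to $\gamma_i$. *)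

(* Defs.v *)
From Stdlib Require Import List Arith.
Import ListNotations.

Definition Cantor := nat -> bool.

Definition Config (S : Type) := S -> Cantor.

(* Product topology on C^S = {0,1}^(S x omega): f is continuous iff each
   output bit (s,i) of f depends only on finitely many input bits. *)
Definition continuous {S : Type} (f : Config S -> Config S) : Prop :=
  forall (k : Config S) (s : S) (i : nat),
    exists L : list (S * nat),
      forall k' : Config S,
        (forall t j, In (t, j) L -> k' t j = k t j) -> f k' s i = f k s i.

Definition homeomorphism {S : Type} (f : Config S -> Config S) : Prop :=
  exists g : Config S -> Config S,
    continuous f /\ continuous g /\
    (forall x, g (f x) = x) /\ (forall x, f (g x) = x).

Definition is_prefix (w : list bool) (x : Cantor) : Prop :=
  forall i, i < length w -> nth i w false = x i.

Definition fin_supp {S : Type} (psi : S -> list bool) : Prop :=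
  exists L : list S, forall s, ~ In s L -> psi s = [].

Definition in_brick {S : Type} (psi : S -> list bool) (k : Config S) : Prop :=
  forall s, is_prefix (psi s) (k s).

Definition wcat (w : list bool) (x : Cantor) : Cantor :=
  fun i => if i <? length w then nth i w false else x (i - length w).

Definition Phi {S : Type} (psi : S -> list bool) (k : Config S) : Config S :=
  fun s => wcat (psi s) (k s).

(* tau_gamma(k)(s) = k(gamma^{-1} s), given gamma^{-1} = ginv *)
Definition tau {S : Type} (ginv : S -> S) (k : Config S) : Config S :=
  fun s => k (ginv s).

Definition brick_partition {S : Type} (n : nat) (phi : nat -> S -> list bool) : Prop :=
  (forall i, i < n -> fin_supp (phi i)) /\
  (forall k : Config S, exists i, i < n /\ in_brick (phi i) k) /\
  (forall i j (k : Config S), i < n -> j < n -> in_brick (phi i) k ->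
      in_brick (phi j) k -> i = j).

Definition perm_group {S : Type} (G : (S -> S) -> Prop) : Prop :=
  (forall g, G g -> (forall x y, g x = g y -> x = y) /\ (forall y, exists x, g x = y)) /\
  G (fun x => x) /\
  (forall g h, G g -> G h -> G (fun x => g (h x))) /\
  (forall g ginv, G g -> (forall x, ginv (g x) = x) -> (forall x, g (ginv x) = x) -> G ginv).

Definition SV {S : Type} (G : (S -> S) -> Prop) (h : Config S -> Config S) : Prop :=
  homeomorphism h /\
  exists (n : nat) (phi psi : nat -> S -> list bool) (gam ginv : nat -> S -> S),
    brick_partition n phi /\ brick_partition n psi /\
    forall i, i < n ->
      G (gam i) /\
      (forall x, ginv i (gam i x) = x) /\ (forall x, gam i (ginv i x) = x) /\
      (forall k : Config S, h (Phi (phi i) k) = Phi (psi i) (tau (ginv i) k)).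

Definition is_id {S : Type} (h : Config S -> Config S) : Prop := forall x, h x = x.

Definition subgroup_of {S : Type} (G : (S -> S) -> Prop)
  (H : (Config S -> Config S) -> Prop) : Prop :=
  (forall h, H h -> SV G h) /\
  H (fun x => x) /\
  (forall f g, H f -> H g -> H (fun x => f (g x))) /\
  (forall f finv, H f -> (forall x, finv (f x) = x) -> (forall x, f (finv x) = x) -> H finv).

Definition normal_subgroup {S : Type} (G : (S -> S) -> Prop)
  (N : (Config S -> Config S) -> Prop) : Prop :=
  subgroup_of G N /\
  (forall g ginv n, SV G g -> (forall x, ginv (g x) = x) -> (forall x, g (ginv x) = x) ->
      N n -> N (fun x => g (n (ginv x)))).

Definition SV_simple {S : Type} (G : (S -> S) -> Prop) : Prop :=
  (exists h, SV G h /\ ~ is_id h) /\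
  forall N, normal_subgroup G N ->
    (forall h, N h -> is_id h) \/ (forall h, SV G h -> N h).

Definition generated_by {S : Type} (G : (S -> S) -> Prop)
  (L : list (Config S -> Config S)) (h : Config S -> Config S) : Prop :=
  forall H, subgroup_of G H -> (forall f, In f L -> H f) -> H h.

Definition generates {S : Type} (G : (S -> S) -> Prop)
  (L : list (Config S -> Config S)) : Prop :=
  (forall f, In f L -> SV G f) /\ (forall h, SV G h -> generated_by G L h).

Definition SV_fin_gen {S : Type} (G : (S -> S) -> Prop) : Prop :=
  exists L, generates G L.

Definition finite_order {S : Type} (h : Config S -> Config S) : Prop :=
  exists n, 1 <= n /\ forall x, Nat.iter n h x = x.

(* Main.v *)
Require Import Defs.
From Stdlib Require Import List Arith.
From Stdlib Require Import Lia Classical ClassicalEpsilon FunctionalExtensionality ProofIrrelevance.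
Import ListNotations.

(**
Simplicity. Let N be a nontrivial normal subgroup and n in N with n(B) disjoint
from a brick B. Then [f, g] = [f (n f^-1 n^-1), g] lies in N for f, g supported
in B, and hence, after conjugation, for f, g supported in any common clopen set
that misses a brick. A swap (h on U, h^-1 on h(U), the identity elsewhere) is
such a commutator, so N contains the swaps with U, h(U) not covering the space.
Modulo N every element may thus be supported in a brick, and two copies of an
element on bricks are congruent. An element k differs from its doubling, which
is two copies of k on the halves given by a first letter, only by where that
letter is inserted; the insertion maps are handled by swaps and by the same
doubling trick. So the copy of k on a brick is congruent to its own square and
lies in N.

Two generators. By simplicity the group is generated by commutators of
involutions, and finitely many involutions f_i suffice if it is finitely
generated. Partition the space into bricks E_0, ..., E_(n-1), let a rotate them
and let b be the product of copies of the f_i on bricks whose indices form a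
Sidon set and of one swap linking E_0 and E_1. The commutator of b with a
conjugate of b by a power of a then is a copy of a single [f_i, f_j], so that a
and b generate all copies of elements on the E_k, and the links between
consecutive bricks; these generate all swaps.
*)

(** * Words and bricks *)

(** Nothing is known about [G], so a twist on a brick is not evidently a product of commutators:
    once the swaps are killed, sending k to the class of its copy on a proper brick is a
    homomorphism that might a priori detect an abelian quotient of [G]. Doubling removes this
    obstruction, since cutting a brick in two turns one copy of a twist into two, up to maps that
    only move a letter. These maps cannot be avoided, because a twist permutes the coordinates: a
    letter inserted at one coordinate before k may reappear at another one after k.

    A factor f_i of b is not isolated by conjugating with powers of a, but a commutator of b with a
    translate of b sees only the bricks that the two share, and the Sidon property leaves a single
    one. Hence the wish for commutators as generators; involutions make b of order two.

    Maps are handled through finite covers by bricks on which they are twists. Such covers compose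
    and glue without common refinements, whereas partitions enter only where the definition of the
    group or a disjoint decomposition asks for them. *)

Definition shift (n : nat) (x : Cantor) : Cantor := fun i => x (i + n).

Lemma shift_0 (x : Cantor) : shift 0 x = x.
Proof. extensionality i. unfold shift. rewrite Nat.add_0_r. reflexivity. Qed.

Lemma wcat_nil (x : Cantor) : wcat [] x = x.
Proof. extensionality i. unfold wcat. simpl. f_equal. lia. Qed.

Lemma wcat_cons_S (c : bool) (w : list bool) (x : Cantor) (i : nat) :
  wcat (c :: w) x (S i) = wcat w x i.
Proof. reflexivity. Qed.

Lemma wcat_app (v w : list bool) (x : Cantor) : wcat v (wcat w x) = wcat (v ++ w) x.
Proof.
  induction v as [|c v IH]; simpl.
  - apply wcat_nil.
  - extensionality i. destruct i as [|i]; [reflexivity|].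
    rewrite !wcat_cons_S, IH. reflexivity.
Qed.

Lemma shift_wcat (w : list bool) (x : Cantor) : shift (length w) (wcat w x) = x.
Proof.
  extensionality i. unfold shift, wcat.
  replace (i + length w <? length w) with false by (symmetry; apply Nat.ltb_ge; lia).
  f_equal. lia.
Qed.

Lemma wcat_shift (w : list bool) (x : Cantor) :
  is_prefix w x -> wcat w (shift (length w) x) = x.
Proof.
  intro H. extensionality i. unfold wcat, shift.
  destruct (Nat.ltb_spec i (length w)) as [Hi|Hi].
  - apply H, Hi.
  - f_equal. lia.
Qed.

Lemma is_prefix_wcat (w : list bool) (x : Cantor) : is_prefix w (wcat w x).
Proof.
  intros i Hi. unfold wcat. rewrite (proj2 (Nat.ltb_lt _ _) Hi). reflexivity.
Qed.

(** Two prefixes of one sequence are comparable, so one of the two [skipn] is empty and both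
    concatenations are the longer word. The single formula for [z] covers both cases. *)
Lemma wcat_join (a b : list bool) (x y : Cantor) :
  wcat a x = wcat b y ->
  let z := shift (length (skipn (length a) b)) x in
  x = wcat (skipn (length a) b) z /\ y = wcat (skipn (length b) a) z /\
  a ++ skipn (length a) b = b ++ skipn (length b) a.
Proof.
  revert b. induction a as [|c a IH]; intros [|d b] H; cbn zeta; cbn [length skipn app].
  - rewrite !wcat_nil in H. subst y. rewrite shift_0, wcat_nil. auto.
  - rewrite wcat_nil in H. subst x. rewrite (shift_wcat (d :: b)), wcat_nil, app_nil_r.
    auto.
  - rewrite wcat_nil in H. subst y. rewrite shift_0, wcat_nil, app_nil_r. auto.
  - assert (Hc : c = d) by exact (f_equal (fun f => f 0) H).
    assert (Ht : wcat a x = wcat b y).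
    { extensionality i. exact (f_equal (fun f => f (S i)) H). }
    specialize (IH b Ht). cbn zeta in IH. destruct IH as (H1 & H2 & H3).
    split; [exact H1|]. split; [exact H2|]. rewrite H3, Hc. reflexivity.
Qed.

Section Bricks.
Context {S : Type}.

Notation brick := (S -> list bool).
Notation X := (Config S).

Definition eqS (s t : S) : {s = t} + {s <> t} := excluded_middle_informative (s = t).

Definition root : brick := fun _ => [].

Definition single (s : S) (w : list bool) : brick := fun t => if eqS t s then w else [].

Definition bcat (a b : brick) : brick := fun s => a s ++ b s.

Definition rest (a b : brick) : brick := fun s => skipn (length (a s)) (b s).

Definition unPhi (a : brick) (x : X) : X := fun s => shift (length (a s)) (x s).

Definition inb (a : brick) (x : X) : Prop := exists u, x = Phi a u.

Lemma single_same (s : S) (w : list bool) : single s w s = w.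
Proof. unfold single. destruct (eqS s s); congruence. Qed.

Lemma single_other (s t : S) (w : list bool) : t <> s -> single s w t = [].
Proof. intro H. unfold single. destruct (eqS t s); congruence. Qed.

Lemma Phi_root (x : X) : Phi root x = x.
Proof. extensionality s. apply wcat_nil. Qed.

Lemma Phi_bcat (a b : brick) (x : X) : Phi a (Phi b x) = Phi (bcat a b) x.
Proof. extensionality s. apply wcat_app. Qed.

Lemma unPhi_Phi (a : brick) (x : X) : unPhi a (Phi a x) = x.
Proof. extensionality s. apply shift_wcat. Qed.

Lemma Phi_inj (a : brick) (x y : X) : Phi a x = Phi a y -> x = y.
Proof. intro H. rewrite <- (unPhi_Phi a x), H. apply unPhi_Phi. Qed.

Lemma Phi_unPhi (a : brick) (x : X) : inb a x -> Phi a (unPhi a x) = x.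
Proof. intros [u ->]. rewrite unPhi_Phi. reflexivity. Qed.

Lemma inb_Phi (a : brick) (x : X) : inb a (Phi a x).
Proof. exists x. reflexivity. Qed.

Lemma inb_root (x : X) : inb root x.
Proof. exists x. symmetry. apply Phi_root. Qed.

Lemma in_brick_inb (a : brick) (x : X) : in_brick a x <-> inb a x.
Proof.
  split.
  - intro H. exists (unPhi a x). extensionality s. symmetry. apply wcat_shift, H.
  - intros [u ->] s. apply is_prefix_wcat.
Qed.

Lemma inb_bcat_l (a b : brick) (x : X) : inb (bcat a b) x -> inb a x.
Proof. intros [u ->]. rewrite <- Phi_bcat. apply inb_Phi. Qed.

Lemma inb_bcat (a b : brick) (x : X) : inb (bcat a b) (Phi a x) <-> inb b x.
Proof.
  split.
  - intros [u H]. rewrite <- Phi_bcat in H. apply Phi_inj in H. exists u. exact H.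
  - intros [u ->]. exists u. apply Phi_bcat.
Qed.

(** Two bricks with a common point meet in the brick [bcat a (rest a b)]: at each coordinate the
    longer word wins. Composition of charts rests on this. *)
Lemma Phi_join (a b : brick) (x y : X) :
  Phi a x = Phi b y ->
  exists z, x = Phi (rest a b) z /\ y = Phi (rest b a) z /\
    bcat a (rest a b) = bcat b (rest b a).
Proof.
  intro H. exists (unPhi (rest a b) x).
  assert (J := fun s => wcat_join (a s) (b s) (x s) (y s) (f_equal (fun f => f s) H)).
  cbn zeta in J.
  repeat split; extensionality s; apply J.
Qed.

Lemma tau_Phi (g : S -> S) (a : brick) (x : X) :
  tau g (Phi a x) = Phi (fun s => a (g s)) (tau g x).
Proof. reflexivity. Qed.

Lemma fin_supp_root : fin_supp root.
Proof. exists []. reflexivity. Qed.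

Lemma fin_supp_single (s : S) (w : list bool) : fin_supp (single s w).
Proof. exists [s]. intros t Ht. apply single_other. intros ->. apply Ht. left. reflexivity. Qed.

Lemma fin_supp_bcat (a b : brick) : fin_supp a -> fin_supp b -> fin_supp (bcat a b).
Proof.
  intros [L HL] [M HM]. exists (L ++ M). intros s Hs. unfold bcat.
  rewrite HL, HM; [reflexivity| |]; intro; apply Hs, in_or_app; auto.
Qed.

Lemma fin_supp_rest (a b : brick) : fin_supp b -> fin_supp (rest a b).
Proof.
  intros [L HL]. exists L. intros s Hs. unfold rest. rewrite HL by exact Hs. apply skipn_nil.
Qed.

Lemma fin_supp_comp (g ginv : S -> S) (a : brick) :
  (forall s, ginv (g s) = s) -> fin_supp a -> fin_supp (fun s => a (g s)).
Proof.
  intros H [L HL]. exists (map ginv L). intros s Hs. apply HL. intro Hi.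
  apply Hs. apply in_map_iff. exists (g s). auto.
Qed.

Lemma fin_supp_len (a : brick) : fin_supp a -> exists L n, (forall s, ~ In s L -> a s = []) /\
  forall s, length (a s) <= n.
Proof.
  intros [L HL]. exists L.
  assert (H : exists n, forall s, In s L -> length (a s) <= n).
  { clear HL. induction L as [|t L [n IH]].
    - exists 0. intros s [].
    - exists (length (a t) + n). intros s [->|Hs]; [lia|]. specialize (IH s Hs). lia. }
  destruct H as [n Hn]. exists n. split; [exact HL|]. intro s.
  destruct (classic (In s L)) as [Hs|Hs]; [auto|]. rewrite HL by exact Hs. simpl. lia.
Qed.

Lemma brick_deeper (a b : brick) (x : X) : inb a x -> inb b x ->
  (forall s, length (a s) <= length (b s)) -> b = bcat a (rest a b).
Proof.
  intros [u ->] [v H] Hl. destruct (Phi_join _ _ _ _ H) as (z & _ & _ & E).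
  rewrite E. extensionality s. unfold bcat, rest.
  rewrite skipn_all2 by apply Hl. symmetry. apply app_nil_r.
Qed.

Lemma bit_Phi_single (s : S) (b : bool) (u : X) : Phi (single s [b]) u s 0 = b.
Proof. unfold Phi. rewrite single_same. reflexivity. Qed.

Lemma inb_single_bit (s : S) (b : bool) (x : X) : inb (single s [b]) x <-> x s 0 = b.
Proof.
  split.
  - intros [u ->]. apply bit_Phi_single.
  - intro H. apply in_brick_inb. intro t. destruct (eqS t s) as [->|Ht].
    + rewrite single_same. intros [|i] Hi; [symmetry; exact H|simpl in Hi; lia].
    + rewrite single_other by exact Ht. intros i Hi. simpl in Hi. lia.
Qed.

Lemma split_bit (s : S) (x : X) : exists b u, x = Phi (single s [b]) u.
Proof. exists (x s 0). apply inb_single_bit. reflexivity. Qed.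

Lemma Phi_single_disj (s : S) (u v : X) : Phi (single s [true]) u <> Phi (single s [false]) v.
Proof.
  intro H. apply (f_equal (fun f => f s 0)) in H. rewrite !bit_Phi_single in H. discriminate.
Qed.

Lemma Phi_single_comm (s t : S) (v w : list bool) (u : X) : s <> t ->
  Phi (single s v) (Phi (single t w) u) = Phi (single t w) (Phi (single s v) u).
Proof.
  intro H. rewrite !Phi_bcat. f_equal. extensionality r. unfold bcat.
  destruct (eqS r s) as [->|Hs].
  - rewrite single_same, single_other by exact H. apply app_nil_r.
  - rewrite (single_other s r) by exact Hs. symmetry. apply app_nil_r.
Qed.

Lemma Phi_single_app (s : S) (v w : list bool) (u : X) :
  Phi (single s v) (Phi (single s w) u) = Phi (single s (v ++ w)) u.
Proof.
  rewrite !Phi_bcat. f_equal. extensionality r. unfold bcat, single.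
  destruct (eqS r s); reflexivity.
Qed.

End Bricks.

(** * Piecewise twist maps *)

Section Charts.
Context {S : Type}.
Notation brick := (S -> list bool).
Notation X := (Config S).

Record chart := Chart { dom : brick; cod : brick; gam : S -> S; gaminv : S -> S }.

Variable G : (S -> S) -> Prop.
Hypothesis HG : perm_group G.

Definition valid (c : chart) : Prop :=
  fin_supp (dom c) /\ fin_supp (cod c) /\ G (gam c) /\
  (forall s, gaminv c (gam c s) = s) /\ (forall s, gam c (gaminv c s) = s).

(* [h] is a twist on each of finitely many bricks that cover [A] exactly. In
   particular [A] has to be compact open. *)
Definition lpw (A : X -> Prop) (h : X -> X) : Prop :=
  exists l : list chart, forall x, A x -> exists c, In c l /\ valid c /\ inb (dom c) x /\
    forall u, A (Phi (dom c) u) /\ h (Phi (dom c) u) = Phi (cod c) (tau (gaminv c) u).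

(** Being a finite union of bricks, encoded as the identity being a piecewise twist on [A].
    Intersections and preimages of such sets then come from [lpw_comp]. *)
Definition opn (A : X -> Prop) : Prop := lpw A (fun x => x).

Definition clopen (A : X -> Prop) : Prop := opn A /\ opn (fun x => ~ A x).

Lemma lpw_ext (A B : X -> Prop) (f g : X -> X) :
  (forall x, A x <-> B x) -> (forall x, A x -> f x = g x) -> lpw A f -> lpw B g.
Proof.
  intros HAB Hfg [l Hl]. exists l. intros x Hx. apply HAB in Hx.
  destruct (Hl x Hx) as (c & Hc & Hv & Hd & Hu). exists c. repeat split; try apply Hv; auto.
  - apply HAB, Hu.
  - rewrite <- Hfg by apply Hu. apply Hu.
Qed.

Lemma lpw_union (A B : X -> Prop) (h : X -> X) :
  lpw A h -> lpw B h -> lpw (fun x => A x \/ B x) h.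
Proof.
  intros [l Hl] [m Hm]. exists (l ++ m). intros x [Hx|Hx].
  - destruct (Hl x Hx) as (c & Hc & Hv & Hd & Hu). exists c.
    split; [apply in_or_app; auto|]. split; [exact Hv|]. split; [exact Hd|].
    intro u. destruct (Hu u). auto.
  - destruct (Hm x Hx) as (c & Hc & Hv & Hd & Hu). exists c.
    split; [apply in_or_app; auto|]. split; [exact Hv|]. split; [exact Hd|].
    intro u. destruct (Hu u). auto.
Qed.

Lemma lpw_chart (c : chart) (h : X -> X) :
  valid c -> (forall u, h (Phi (dom c) u) = Phi (cod c) (tau (gaminv c) u)) ->
  lpw (inb (dom c)) h.
Proof.
  intros Hv Hh. exists [c]. intros x Hx. exists c. repeat split; try apply Hv; auto.
  - left. reflexivity.
  - apply inb_Phi.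
Qed.

Lemma lpw_id_chart (a b : brick) (h : X -> X) :
  fin_supp a -> fin_supp b -> (forall u, h (Phi a u) = Phi b u) -> lpw (inb a) h.
Proof.
  intros Ha Hb Hh. apply (lpw_chart (Chart a b (fun s => s) (fun s => s))); [|exact Hh].
  repeat split; simpl; auto. apply HG.
Qed.

(** The domain is the part of [dom c1] that lands in [dom c2]. Inside [cod c1] it is cut out by
    [rest (cod c1) (dom c2)], which [gam c1] relabels to source coordinates; the opposite remainder
    is relabelled by [gaminv c2] to target coordinates. *)
Definition ccomp (c2 c1 : chart) : chart :=
  Chart (bcat (dom c1) (fun s => rest (cod c1) (dom c2) (gam c1 s)))
        (bcat (cod c2) (fun s => rest (dom c2) (cod c1) (gaminv c2 s)))
        (fun s => gam c2 (gam c1 s)) (fun s => gaminv c1 (gaminv c2 s)).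

Lemma ccomp_valid (c2 c1 : chart) : valid c2 -> valid c1 -> valid (ccomp c2 c1).
Proof.
  intros (D2 & C2 & G2 & L2 & R2) (D1 & C1 & G1 & L1 & R1).
  split; [|split; [|split; [|split]]]; simpl.
  - apply fin_supp_bcat; [exact D1|].
    apply (fin_supp_comp (gam c1) (gaminv c1) (rest (cod c1) (dom c2)) L1).
    apply fin_supp_rest, D2.
  - apply fin_supp_bcat; [exact C2|].
    apply (fin_supp_comp (gaminv c2) (gam c2) (rest (dom c2) (cod c1)) R2).
    apply fin_supp_rest, C1.
  - apply (proj1 (proj2 (proj2 HG))); assumption.
  - intro s. rewrite L2. apply L1.
  - intro s. rewrite R1. apply R2.
Qed.

(** All pairs of charts are listed. Pairs whose bricks do not meet are harmless, since the list only
    has to contain a suitable chart for each point. *)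
Lemma lpw_comp (A B : X -> Prop) (f g : X -> X) :
  lpw A f -> lpw B g -> lpw (fun x => A x /\ B (f x)) (fun x => g (f x)).
Proof.
  intros [l Hl] [m Hm].
  exists (flat_map (fun c1 => map (fun c2 => ccomp c2 c1) m) l).
  intros x [Ax Bx].
  destruct (Hl x Ax) as (c1 & In1 & V1 & [u Hu] & U1).
  destruct (Hm _ Bx) as (c2 & In2 & V2 & [v Hv] & U2).
  exists (ccomp c2 c1). split.
  { apply in_flat_map. exists c1. split; [exact In1|].
    apply in_map_iff. exists c2. auto. }
  split; [apply ccomp_valid; assumption|].
  rewrite Hu, (proj2 (U1 u)) in Hv.
  destruct (Phi_join _ _ _ _ Hv) as (z & Hz & _ & E).
  destruct V1 as (D1 & C1 & G1 & L1 & R1).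
  assert (Hu' : u = Phi (fun s => rest (cod c1) (dom c2) (gam c1 s)) (tau (gam c1) z)).
  { rewrite <- tau_Phi, <- Hz. extensionality s. unfold tau. rewrite L1. reflexivity. }
  split.
  - exists (tau (gam c1) z). simpl. rewrite <- Phi_bcat, <- Hu'. exact Hu.
  - intro w. simpl. rewrite <- Phi_bcat.
    set (w' := Phi (fun s => rest (cod c1) (dom c2) (gam c1 s)) w).
    destruct (U1 w') as [Aw Ew].
    assert (Ew' : f (Phi (dom c1) w') =
      Phi (dom c2) (Phi (rest (dom c2) (cod c1)) (tau (gaminv c1) w))).
    { rewrite Ew, Phi_bcat, <- E, <- Phi_bcat. f_equal. unfold w'. rewrite tau_Phi. f_equal.
      extensionality s. rewrite R1. reflexivity. }
    rewrite Ew'.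
    destruct (U2 (Phi (rest (dom c2) (cod c1)) (tau (gaminv c1) w))) as [Bw Fw].
    split; [auto|]. rewrite Fw, tau_Phi, Phi_bcat. reflexivity.
Qed.

Lemma lpw_opn (A : X -> Prop) (h : X -> X) : lpw A h -> opn A.
Proof.
  intros [l Hl]. exists (map (fun c => Chart (dom c) (dom c) (fun s => s) (fun s => s)) l).
  intros x Hx. destruct (Hl x Hx) as (c & Hc & (D & _) & Hd & Hu).
  exists (Chart (dom c) (dom c) (fun s => s) (fun s => s)). split; [|split; [|split]].
  - apply in_map_iff. exists c. auto.
  - repeat split; simpl; auto. apply HG.
  - exact Hd.
  - intro u. split; [apply Hu|reflexivity].
Qed.

Lemma lpw_restrict (A B : X -> Prop) (h : X -> X) :
  lpw A h -> opn B -> lpw (fun x => A x /\ B x) h.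
Proof.
  intros H K. apply (lpw_ext (fun x => B x /\ A x) _ h h); [tauto|auto|].
  exact (lpw_comp B A (fun x => x) h K H).
Qed.

Lemma opn_pre (A B : X -> Prop) (h : X -> X) :
  lpw A h -> opn B -> opn (fun x => A x /\ B (h x)).
Proof. intros H K. exact (lpw_opn _ _ (lpw_comp A B h (fun x => x) H K)). Qed.

Lemma lpw_True_root (h : X -> X) :
  (forall u, h u = u) -> lpw (fun _ => True) h.
Proof.
  intro H. apply (lpw_ext (inb root) _ h h); [|auto|].
  - intro x. split; [auto|]. intros _. apply inb_root.
  - apply (lpw_id_chart root root); try apply fin_supp_root.
    intro u. rewrite Phi_root. apply H.
Qed.

Lemma opn_True : opn (fun _ => True).
Proof. apply lpw_True_root. reflexivity. Qed.

Lemma opn_brick (a : brick) : fin_supp a -> opn (inb a).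
Proof. intro Ha. apply (lpw_id_chart a a); auto. Qed.

Lemma opn_list (A : X -> Prop) (l : list brick) :
  (forall x, A x -> exists a, In a l /\ fin_supp a /\ inb a x /\ forall u, A (Phi a u)) -> opn A.
Proof.
  intro H. exists (map (fun a => Chart a a (fun s => s) (fun s => s)) l). intros x Hx.
  destruct (H x Hx) as (a & Hi & Ha & Hin & Hu). eexists. split.
  - apply in_map_iff. exists a. split; [reflexivity|exact Hi].
  - split; [repeat split; simpl; auto; apply HG|]. split; [exact Hin|].
    intro u. split; [apply Hu|reflexivity].
Qed.

(* A point misses the brick [a] at a first letter of some word [a s]. *)
Lemma opn_not_brick (a : brick) : fin_supp a -> opn (fun x => ~ inb a x).
Proof.
  intros [L HL].
  apply (opn_list _ (flat_map (fun s => map (fun i =>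
    single s (firstn i (a s) ++ [negb (nth i (a s) false)])) (seq 0 (length (a s)))) L)).
  intros x Hx.
  assert (E : exists s i, i < length (a s) /\ nth i (a s) false <> x s i).
  { apply NNPP. intro K. apply Hx, in_brick_inb. intros s i Hi.
    apply NNPP. intro E. apply K. exists s, i. auto. }
  destruct E as (s & E).
  destruct (dec_inh_nat_subset_has_unique_least_element
    (fun i => i < length (a s) /\ nth i (a s) false <> x s i)) as (i & ((Hi & Ne) & Hmin) & _).
  { intro n. apply classic. }
  { exact E. }
  assert (Len : length (firstn i (a s)) = i) by (rewrite length_firstn; lia).
  exists (single s (firstn i (a s) ++ [negb (nth i (a s) false)])).
  split; [|split; [|split]].
  - apply in_flat_map. exists s. split.
    + apply NNPP. intro K. rewrite (HL s K) in Hi. simpl in Hi. lia.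
    + apply in_map_iff. exists i. split; [reflexivity|]. apply in_seq. lia.
  - apply fin_supp_single.
  - apply in_brick_inb. intro t. destruct (eqS t s) as [->|Ht].
    + rewrite single_same. intros j Hj. rewrite length_app, Len in Hj. simpl in Hj.
      destruct (Nat.eq_dec j i) as [->|Hj'].
      * rewrite app_nth2 by lia. rewrite Len, Nat.sub_diag. simpl.
        destruct (nth i (a s) false), (x s i); simpl in *; congruence.
      * rewrite app_nth1 by lia. rewrite nth_firstn.
        replace (j <? i) with true by (symmetry; apply Nat.ltb_lt; lia).
        apply NNPP. intro K. assert (i <= j) by (apply Hmin; split; [lia|exact K]). lia.
    + rewrite single_other by exact Ht. intros j Hj. simpl in Hj. lia.
  - intros u K. apply in_brick_inb in K. specialize (K s i Hi).
    unfold Phi in K. rewrite single_same in K. unfold wcat in K.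
    rewrite length_app, Len in K. simpl in K.
    replace (i <? i + 1) with true in K by (symmetry; apply Nat.ltb_lt; lia).
    rewrite app_nth2, Len, Nat.sub_diag in K by lia. simpl in K.
    destruct (nth i (a s) false); discriminate.
Qed.

Lemma clopen_brick (a : brick) : fin_supp a -> clopen (inb a).
Proof. intro Ha. split; [apply opn_brick|apply opn_not_brick]; exact Ha. Qed.

Lemma opn_ext (A B : X -> Prop) : (forall x, A x <-> B x) -> opn A -> opn B.
Proof. intros H. apply lpw_ext; auto. Qed.

Lemma opn_or (A B : X -> Prop) : opn A -> opn B -> opn (fun x => A x \/ B x).
Proof. apply lpw_union. Qed.

Lemma opn_and (A B : X -> Prop) : opn A -> opn B -> opn (fun x => A x /\ B x).
Proof. apply lpw_restrict. Qed.

Lemma clopen_not (A : X -> Prop) : clopen A -> clopen (fun x => ~ A x).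
Proof.
  intros [H K]. split; [exact K|]. apply (opn_ext A); [|exact H].
  intro x. split; [tauto|apply NNPP].
Qed.

Lemma clopen_and (A B : X -> Prop) : clopen A -> clopen B -> clopen (fun x => A x /\ B x).
Proof.
  intros [H K] [H' K']. split; [apply opn_and; assumption|].
  apply (opn_ext (fun x => ~ A x \/ ~ B x)); [|apply opn_or; assumption].
  intro x. destruct (classic (A x)), (classic (B x)); tauto.
Qed.

Lemma clopen_pre (A : X -> Prop) (h : X -> X) :
  lpw (fun _ => True) h -> clopen A -> clopen (fun x => A (h x)).
Proof.
  intros Hh [H K]. split.
  - apply (opn_ext (fun x => True /\ A (h x))); [tauto|]. apply opn_pre; assumption.
  - apply (opn_ext (fun x => True /\ ~ A (h x))); [tauto|].
    exact (opn_pre _ (fun x => ~ A x) _ Hh K).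
Qed.

Lemma lpw_glue (U : X -> Prop) (h : X -> X) :
  lpw U h -> lpw (fun x => ~ U x) h -> lpw (fun _ => True) h.
Proof.
  intros H K. apply (lpw_ext (fun x => U x \/ ~ U x) _ h h); [|auto|].
  - intro x. destruct (classic (U x)); tauto.
  - apply lpw_union; assumption.
Qed.

Lemma lpw_inv (f g : X -> X) : (forall x, g (f x) = x) -> (forall x, f (g x) = x) ->
  lpw (fun _ => True) f -> lpw (fun _ => True) g.
Proof.
  intros gf fg [l Hl].
  exists (map (fun c => Chart (cod c) (dom c) (gaminv c) (gam c)) l).
  intros y _. destruct (Hl (g y) I) as (c & Hc & (D & C & Gc & L & R) & [u Hd] & Hu).
  exists (Chart (cod c) (dom c) (gaminv c) (gam c)). split; [|split; [|split]].
  - apply in_map_iff. exists c. auto.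
  - repeat split; simpl; auto.
    apply (proj2 (proj2 (proj2 HG)) (gam c)); assumption.
  - simpl. exists (tau (gaminv c) u). rewrite <- (proj2 (Hu u)), <- Hd. symmetry. apply fg.
  - intro v. simpl. split; [exact I|].
    destruct (Hu (tau (gam c) v)) as [_ E].
    assert (T : tau (gaminv c) (tau (gam c) v) = v).
    { extensionality s. unfold tau. rewrite R. reflexivity. }
    rewrite T in E. rewrite <- E. apply gf.
Qed.

Lemma opn_nbhd (A : X -> Prop) (x : X) : opn A -> A x ->
  exists a, fin_supp a /\ inb a x /\ forall y, inb a y -> A y.
Proof.
  intros [l Hl] Hx. destruct (Hl x Hx) as (c & _ & (D & _) & Hd & Hu).
  exists (dom c). split; [exact D|]. split; [exact Hd|].
  intros y [u ->]. apply Hu.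
Qed.

(** * Piecewise twist homeomorphisms are the elements of SV *)

Lemma lpw_continuous (h : X -> X) : lpw (fun _ => True) h -> continuous h.
Proof.
  intros [l Hl] k s i. destruct (Hl k I) as (c & _ & (D & _) & [u Hd] & Hu).
  destruct (fin_supp_len _ D) as (M & n & HM & Hn).
  (* The first entry is the input bit copied to output bit [i] at [s]; if [i] lies inside the word
     [cod c s], truncated subtraction makes it some harmless bit. The other entries force [k'] into
     the brick [dom c]. *)
  exists ((gaminv c s, i - length (cod c s) + length (dom c (gaminv c s))) ::
          flat_map (fun t => map (fun j => (t, j)) (seq 0 n)) M).
  intros k' Hk.
  assert (Hd' : inb (dom c) k').
  { apply in_brick_inb. intros t j Hj. rewrite Hk.
    - subst k. apply in_brick_inb; [apply inb_Phi|exact Hj].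
    - right. apply in_flat_map. exists t. split.
      + apply NNPP. intro K. rewrite (HM t K) in Hj. simpl in Hj. lia.
      + apply in_map_iff. exists j. split; [reflexivity|]. apply in_seq.
        specialize (Hn t). lia. }
  destruct Hd' as [u' Hu'].
  assert (E : u' (gaminv c s) (i - length (cod c s)) = u (gaminv c s) (i - length (cod c s))).
  { rewrite <- (unPhi_Phi (dom c) u'), <- (unPhi_Phi (dom c) u), <- Hu', <- Hd.
    apply Hk. left. reflexivity. }
  rewrite Hu', Hd, (proj2 (Hu u)), (proj2 (Hu u')).
  unfold Phi, tau, wcat. destruct (i <? length (cod c s)); [reflexivity|exact E].
Qed.

Lemma SV_lpw (h : X -> X) : SV G h -> lpw (fun _ => True) h.
Proof.
  intros (_ & n & phi & psi & ga & gi & (F & C & _) & (F' & _) & H).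
  exists (map (fun i => Chart (phi i) (psi i) (ga i) (gi i)) (seq 0 n)).
  intros x _. destruct (C x) as (i & Hi & Hx). destruct (H i Hi) as (Gi & L & R & E).
  exists (Chart (phi i) (psi i) (ga i) (gi i)). split; [|split; [|split]].
  - apply in_map_iff. exists i. split; [reflexivity|]. apply in_seq. lia.
  - repeat split; simpl; auto.
  - apply in_brick_inb, Hx.
  - intro u. split; [exact I|apply E].
Qed.

(** Part [j] is cut by its next letter at [s] into the parts with indices [2 * j] and
    [2 * j + 1]. *)
Lemma brick_partition_double (n : nat) (phi : nat -> brick) (s : S) :
  brick_partition n phi ->
  brick_partition (2 * n) (fun i => bcat (phi (i / 2)) (single s [Nat.odd i])).
Proof.
  assert (Hlt : forall i, i < 2 * n -> i / 2 < n) by (intros; apply Nat.Div0.div_lt_upper_bound; lia).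
  intros (F & C & D). split; [|split].
  - intros i Hi. apply fin_supp_bcat; [apply F, Hlt, Hi|apply fin_supp_single].
  - intro k. destruct (C k) as (i & Hi & Hk). apply in_brick_inb in Hk. destruct Hk as [u ->].
    destruct (split_bit s u) as (b & v & ->).
    exists (2 * i + Nat.b2n b). split; [destruct b; simpl; lia|].
    assert (E : (2 * i + Nat.b2n b) / 2 = i).
    { symmetry. apply (Nat.div_unique _ _ _ (Nat.b2n b)); [destruct b; simpl; lia|reflexivity]. }
    rewrite E, Nat.add_comm, Nat.odd_add_mul_2.
    replace (Nat.odd (Nat.b2n b)) with b by (destruct b; reflexivity).
    apply in_brick_inb. exists v. apply Phi_bcat.
  - intros i j k Hi Hj Ki Kj. apply in_brick_inb in Ki, Kj.
    assert (E : i / 2 = j / 2).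
    { apply (D _ _ k); try apply Hlt; try assumption; apply in_brick_inb;
      eapply inb_bcat_l; eassumption. }
    destruct Ki as [u Hu]. destruct Kj as [v Hv]. rewrite Hu in Hv.
    rewrite <- !Phi_bcat, E in Hv. apply Phi_inj in Hv.
    apply (f_equal (fun f => f s 0)) in Hv. rewrite !bit_Phi_single in Hv.
    rewrite (Nat.div_mod_eq i 2), (Nat.div_mod_eq j 2), E.
    rewrite <- !Nat.bit0_mod, !Nat.bit0_odd, Hv. reflexivity.
Qed.

Lemma brick_partition_root : brick_partition 1 (fun _ => @root S).
Proof.
  split; [|split].
  - intros. apply fin_supp_root.
  - intro k. exists 0. split; [lia|]. apply in_brick_inb, inb_root.
  - intros. lia.
Qed.

Lemma brick_partition_deep (F : list S) (d : nat) :
  exists n phi, brick_partition n phi /\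
    forall i s, i < n -> In s F -> d <= length (phi i s).
Proof.
  induction F as [|t F (n & phi & P & HP)].
  - exists 1, (fun _ => root). split; [apply brick_partition_root|]. intros i s _ [].
  - assert (H : exists n phi, brick_partition n phi /\
      forall i s, i < n -> (In s F -> d <= length (phi i s)) /\ (s = t -> d <= length (phi i s))).
    { clear -P HP.
      assert (H : forall e, exists n phi, brick_partition n phi /\
        forall i s, i < n -> (In s F -> d <= length (phi i s)) /\ (s = t -> e <= length (phi i s))).
      { induction e as [|e (n' & phi' & P' & H')].
        - exists n, phi. split; [exact P|]. intros i s Hi. split; [auto|intros _; lia].
        - exists (2 * n'), (fun i => bcat (phi' (i / 2)) (single t [Nat.odd i])).
          split; [apply brick_partition_double, P'|]. intros i s Hi.
          assert (Hi' : i / 2 < n') by (apply Nat.Div0.div_lt_upper_bound; lia).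
          destruct (H' _ s Hi') as [H1 H2]. unfold bcat. rewrite length_app. split.
          + intro Hs. specialize (H1 Hs). lia.
          + intros ->. rewrite single_same. specialize (H2 eq_refl). cbn [length]. lia. }
      apply H. }
    destruct H as (n' & phi' & P' & H'). exists n', phi'. split; [exact P'|].
    intros i s Hi [Hs|Hs]; destruct (H' i s Hi); auto.
Qed.

Lemma chart_list_depth (l : list chart) : exists F d, forall c, In c l -> valid c ->
  forall s, length (dom c s) <= d /\ (~ In s F -> dom c s = []).
Proof.
  induction l as [|c l (F & d & IH)].
  - exists [], 0. intros c [].
  - destruct (classic (valid c)) as [V|V].
    + destruct (fin_supp_len _ (proj1 V)) as (M & n & HM & Hn).
      exists (M ++ F), (n + d). intros c' [<-|Hc] V' s.
      * split; [specialize (Hn s); lia|]. intro Hs. apply HM. intro. apply Hs, in_or_app. auto.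
      * destruct (IH c' Hc V' s) as [H1 H2]. split; [lia|].
        intro Hs. apply H2. intro. apply Hs, in_or_app. auto.
    + exists F, d. intros c' [<-|Hc] V' s; [contradiction|]. apply IH; assumption.
Qed.

(** The chart domains cover the space but may overlap. A partition that is deep enough on the
    finitely many coordinates read by the charts refines them all, so each part lies in one chart
    domain. The images of the parts form a partition because [f] is a bijection. *)
Lemma lpw_SV (f g : X -> X) : (forall x, g (f x) = x) -> (forall x, f (g x) = x) ->
  lpw (fun _ => True) f -> SV G f.
Proof.
  intros gf fg Hf. split.
  { exists g. split; [apply lpw_continuous, Hf|]. split; [|auto].
    apply lpw_continuous, (lpw_inv f g); assumption. }
  destruct Hf as [l Hl].
  destruct (chart_list_depth l) as (F & d & HFd).
  destruct (brick_partition_deep F d) as (n & phi & P & HP).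
  assert (Hc : forall i, exists c : chart, i < n -> valid c /\
    dom c = phi i /\ forall u, f (Phi (phi i) u) = Phi (cod c) (tau (gaminv c) u)).
  { intro i. destruct (classic (i < n)) as [Hi|Hi];
      [|exists (Chart root root (fun s => s) (fun s => s)); lia].
    (* Any point of the part will do: it selects a chart, whose domain then contains the whole
       part. *)
    set (x := Phi (phi i) (fun _ _ => false)).
    destruct (Hl x I) as (c & Hc & V & Hx & Hu).
    assert (E : phi i = bcat (dom c) (rest (dom c) (phi i))).
    { apply (brick_deeper _ _ x); [exact Hx|apply inb_Phi|]. intro s.
      destruct (HFd c Hc V s) as [H1 H2].
      destruct (classic (In s F)) as [Hs|Hs].
      - specialize (HP i s Hi Hs). lia.
      - rewrite H2 by exact Hs. simpl. lia. }
    exists (Chart (phi i) (bcat (cod c) (fun s => rest (dom c) (phi i) (gaminv c s)))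
      (gam c) (gaminv c)).
    intros _. destruct V as (D & C & Gc & L & R). split; [|split].
    - repeat split; simpl; auto; [apply P, Hi|]. apply fin_supp_bcat; [exact C|].
      apply (fin_supp_comp (gaminv c) (gam c) (rest (dom c) (phi i)) R).
      apply fin_supp_rest, P, Hi.
    - reflexivity.
    - intro u. simpl. rewrite E at 1. rewrite <- Phi_bcat, (proj2 (Hu _)), tau_Phi, Phi_bcat.
      reflexivity. }
  set (c := fun i => proj1_sig (constructive_indefinite_description _ (Hc i))).
  assert (Hcc : forall i, i < n -> valid (c i) /\ dom (c i) = phi i /\
    forall u, f (Phi (phi i) u) = Phi (cod (c i)) (tau (gaminv (c i)) u)).
  { intro i. exact (proj2_sig (constructive_indefinite_description _ (Hc i))). }
  clearbody c. clear Hc.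
  assert (Himg : forall i x, i < n -> inb (cod (c i)) x <-> inb (phi i) (g x)).
  { intros i x Hi. destruct (Hcc i Hi) as ((_ & _ & _ & L & R) & _ & E). split.
    - intros [u ->]. exists (tau (gam (c i)) u). rewrite <- (gf (Phi (phi i) _)), E. f_equal. f_equal.
      extensionality s. unfold tau. rewrite R. reflexivity.
    - intros [u Hu]. rewrite <- (fg x), Hu, E. apply inb_Phi. }
  destruct P as (PF & PC & PD).
  exists n, phi, (fun i => cod (c i)), (fun i => gam (c i)), (fun i => gaminv (c i)).
  split; [split; [|split]; assumption|]. split; [split; [|split]|].
  - intros i Hi. apply (Hcc i Hi).
  - intro k. destruct (PC (g k)) as (i & Hi & Hk). exists i. split; [exact Hi|].
    apply in_brick_inb, Himg; [exact Hi|]. apply in_brick_inb, Hk.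
  - intros i j k Hi Hj Ki Kj. apply (PD i j (g k)); try assumption;
      apply in_brick_inb, Himg; try assumption; apply in_brick_inb; assumption.
  - intros i Hi. destruct (Hcc i Hi) as ((_ & _ & Gc & L & R) & _ & E). auto.
Qed.

End Charts.

(** * The group of piecewise twist homeomorphisms *)

Ltac fs := auto using @fin_supp_bcat, @fin_supp_single, @fin_supp_root.

Existing Class perm_group.

Section Group.
Context {S : Type}.
Notation brick := (S -> list bool).
Notation X := (Config S).
Context {G : (S -> S) -> Prop} {HG : perm_group G}.

(** Carrying the inverse makes [inv] a function, and by extensionality and proof irrelevance the
    group laws are Leibniz equalities. *)
Record El := MkEl {
  fw :> X -> X; bw : X -> X;
  bw_fw : forall x, bw (fw x) = x;
  fw_bw : forall x, fw (bw x) = x;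
  fw_lpw : lpw G (fun _ => True) fw }.

Lemma El_ext (f g : El) : (forall x, f x = g x) -> f = g.
Proof.
  intro H. destruct f as [f f' a b c], g as [g g' a' b' c']. simpl in H.
  assert (E : f = g) by (extensionality x; apply H). subst g.
  assert (E : f' = g').
  { extensionality x. rewrite <- (b' x) at 1. apply a. }
  subst g'. f_equal; apply proof_irrelevance.
Qed.

Definition one : El :=
  MkEl (fun x => x) (fun x => x) (fun x => eq_refl) (fun x => eq_refl) (opn_True G HG).

Definition inv (f : El) : El :=
  MkEl (bw f) f (fw_bw f) (bw_fw f) (lpw_inv G HG f (bw f) (bw_fw f) (fw_bw f) (fw_lpw f)).

Lemma lpw_total_comp (f g : X -> X) : lpw G (fun _ => True) f -> lpw G (fun _ => True) g ->
  lpw G (fun _ => True) (fun x => f (g x)).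
Proof.
  intros Hf Hg. apply (lpw_ext G (fun x => True /\ True) _ (fun x => f (g x))); [tauto|auto|].
  exact (lpw_comp G HG _ _ _ _ Hg Hf).
Qed.

Definition mul (f g : El) : El.
Proof.
  refine (MkEl (fun x => f (g x)) (fun x => bw g (bw f x)) _ _
    (lpw_total_comp f g (fw_lpw f) (fw_lpw g))).
  - intro x. rewrite !bw_fw. reflexivity.
  - intro x. rewrite !fw_bw. reflexivity.
Defined.

Infix "**" := mul (at level 40, left associativity).

Lemma mul_fw (f g : El) (x : X) : (f ** g) x = f (g x).
Proof. reflexivity. Qed.

Lemma mulA (f g h : El) : (f ** g) ** h = f ** (g ** h).
Proof. apply El_ext. reflexivity. Qed.
Lemma mul1 (f : El) : one ** f = f.
Proof. apply El_ext. reflexivity. Qed.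
Lemma mulr1 (f : El) : f ** one = f.
Proof. apply El_ext. reflexivity. Qed.
Lemma mulV (f : El) : inv f ** f = one.
Proof. apply El_ext. apply bw_fw. Qed.
Lemma mulrV (f : El) : f ** inv f = one.
Proof. apply El_ext. apply fw_bw. Qed.
Lemma mulVK (f g : El) : inv f ** (f ** g) = g.
Proof. apply El_ext. intro x. exact (bw_fw f (g x)). Qed.
Lemma mulKV (f g : El) : f ** (inv f ** g) = g.
Proof. apply El_ext. intro x. exact (fw_bw f (g x)). Qed.
Lemma invK (f : El) : inv (inv f) = f.
Proof. apply El_ext. reflexivity. Qed.
Lemma invM (f g : El) : inv (f ** g) = inv g ** inv f.
Proof. apply El_ext. reflexivity. Qed.
Lemma inv1 : inv one = one.
Proof. apply El_ext. reflexivity. Qed.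

Lemma fw_inv (f : El) (x : X) : f (inv f x) = x.
Proof. apply fw_bw. Qed.
Lemma inv_fw (f : El) (x : X) : inv f (f x) = x.
Proof. apply bw_fw. Qed.
Lemma El_inj (f : El) (x y : X) : f x = f y -> x = y.
Proof. intro H. rewrite <- (inv_fw f x), H. apply inv_fw. Qed.

Lemma inv_unique (f g : El) : f ** g = one -> inv f = g.
Proof. intro H. rewrite <- (mulVK f g), H. symmetry. apply mulr1. Qed.

(* Junk value: the identity when [f] and [g] are not inverse piecewise twist maps. *)
Definition mk (f g : X -> X) : El :=
  match excluded_middle_informative
    ((forall x, g (f x) = x) /\ (forall x, f (g x) = x) /\ lpw G (fun _ => True) f) with
  | left H => MkEl f g (proj1 H) (proj1 (proj2 H)) (proj2 (proj2 H))
  | right _ => one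
  end.

Lemma mk_fw (f g : X -> X) : (forall x, g (f x) = x) -> (forall x, f (g x) = x) ->
  lpw G (fun _ => True) f -> forall x, mk f g x = f x.
Proof.
  intros H1 H2 H3 x. unfold mk. destruct (excluded_middle_informative _) as [H|H]; [reflexivity|].
  exfalso. apply H. auto.
Qed.

Definition ifP {A : Type} (P : Prop) (a b : A) : A :=
  if excluded_middle_informative P then a else b.

Lemma ifT {A : Type} (P : Prop) (a b : A) : P -> ifP P a b = a.
Proof. intro H. unfold ifP. destruct (excluded_middle_informative P); tauto. Qed.
Lemma ifF {A : Type} (P : Prop) (a b : A) : ~ P -> ifP P a b = b.
Proof. intro H. unfold ifP. destruct (excluded_middle_informative P); tauto. Qed.

Lemma lpw_if (U : X -> Prop) (f g : X -> X) : clopen G U ->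
  lpw G (fun _ => True) f -> lpw G (fun _ => True) g ->
  lpw G (fun _ => True) (fun x => ifP (U x) (f x) (g x)).
Proof.
  intros [HU HU'] Hf Hg. apply (lpw_glue G U).
  - apply (lpw_ext G (fun x => True /\ U x) _ f); [tauto| |].
    + intros x [_ Hx]. symmetry. apply ifT, Hx.
    + exact (lpw_restrict G HG _ _ _ Hf HU).
  - apply (lpw_ext G (fun x => True /\ ~ U x) _ g); [tauto| |].
    + intros x [_ Hx]. symmetry. apply ifF, Hx.
    + exact (lpw_restrict G HG _ _ _ Hg HU').
Qed.

Lemma lpw_brick (a : brick) (f : X -> X) :
  fin_supp a -> lpw G (inb a) f -> (forall x, ~ inb a x -> f x = x) -> lpw G (fun _ => True) f.
Proof.
  intros Ha Hf Hid. apply (lpw_glue G (inb a)); [exact Hf|].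
  apply (lpw_ext G (fun x => ~ inb a x) _ (fun x => x)); [tauto| |].
  - intros x Hx. symmetry. apply Hid, Hx.
  - apply (opn_not_brick G HG a Ha).
Qed.

(** * Copies of an element on a brick *)

Definition copyf (a : brick) (f : X -> X) (x : X) : X :=
  ifP (inb a x) (Phi a (f (unPhi a x))) x.

Definition copy (a : brick) (k : El) : El := mk (copyf a k) (copyf a (inv k)).

Lemma copyf_in (a : brick) (f : X -> X) (u : X) : copyf a f (Phi a u) = Phi a (f u).
Proof. unfold copyf. rewrite ifT, unPhi_Phi by apply inb_Phi. reflexivity. Qed.

Lemma copyf_out (a : brick) (f : X -> X) (x : X) : ~ inb a x -> copyf a f x = x.
Proof. apply ifF. Qed.

Lemma copyf_cancel (a : brick) (f g : X -> X) : (forall x, g (f x) = x) ->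
  forall x, copyf a g (copyf a f x) = x.
Proof.
  intros H x. destruct (classic (inb a x)) as [[u ->]|Hx].
  - rewrite !copyf_in, H. reflexivity.
  - rewrite (copyf_out a f), copyf_out; auto.
Qed.

Lemma lpw_Phi (a : brick) : fin_supp a -> lpw G (fun _ => True) (Phi a).
Proof.
  intro Ha. apply (lpw_ext G (inb root) _ (Phi a)); [|auto|].
  - intro x. split; [auto|]. intros _. apply inb_root.
  - apply (lpw_id_chart G HG root a); fs. intro u. rewrite Phi_root. reflexivity.
Qed.

Lemma lpw_unPhi (a : brick) : fin_supp a -> lpw G (inb a) (unPhi a).
Proof.
  intro Ha. apply (lpw_id_chart G HG a root); fs.
  intro u. rewrite Phi_root. apply unPhi_Phi.
Qed.

Lemma copy_fw (a : brick) (k : El) (x : X) : fin_supp a -> copy a k x = copyf a k x.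
Proof.
  intro Ha. apply mk_fw.
  - apply copyf_cancel, inv_fw.
  - apply copyf_cancel, fw_inv.
  - apply (lpw_brick a _ Ha); [|apply copyf_out].
    apply (lpw_ext G (fun x => inb a x /\ True) _ (fun x => Phi a (k (unPhi a x)))); [tauto| |].
    + intros y [[u ->] _]. rewrite copyf_in, unPhi_Phi. reflexivity.
    + apply (lpw_comp G HG (inb a) (fun _ => True) (unPhi a) (fun x => Phi a (k x))).
      * apply lpw_unPhi, Ha.
      * apply (lpw_total_comp (Phi a) k); [apply lpw_Phi, Ha|apply fw_lpw].
Qed.

Lemma copy_in (a : brick) (k : El) (u : X) : fin_supp a -> copy a k (Phi a u) = Phi a (k u).
Proof. intro Ha. rewrite copy_fw by exact Ha. apply copyf_in. Qed.

Lemma copy_out (a : brick) (k : El) (x : X) : fin_supp a -> ~ inb a x -> copy a k x = x.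
Proof. intros Ha. rewrite copy_fw by exact Ha. apply copyf_out. Qed.

Lemma copy_eq (a : brick) (k f : El) : fin_supp a ->
  (forall u, f (Phi a u) = Phi a (k u)) -> (forall x, ~ inb a x -> f x = x) -> f = copy a k.
Proof.
  intros Ha H1 H2. apply El_ext. intro x. destruct (classic (inb a x)) as [[u ->]|Hx].
  - rewrite copy_in by exact Ha. apply H1.
  - rewrite copy_out by assumption. apply H2, Hx.
Qed.

Lemma copy_mul (a : brick) (f g : El) : fin_supp a -> copy a f ** copy a g = copy a (f ** g).
Proof.
  intro Ha. apply copy_eq; [exact Ha| |].
  - intro u. rewrite mul_fw, !copy_in by exact Ha. reflexivity.
  - intros x Hx. rewrite mul_fw, !copy_out; auto. rewrite copy_out; auto.
Qed.

Lemma copy_one (a : brick) : fin_supp a -> copy a one = one.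
Proof. intro Ha. symmetry. apply copy_eq; auto. Qed.

Lemma copy_inv (a : brick) (f : El) : fin_supp a -> inv (copy a f) = copy a (inv f).
Proof. intro Ha. apply inv_unique. rewrite copy_mul, mulrV by exact Ha. apply copy_one, Ha. Qed.

Lemma copy_copy (a b : brick) (f : El) : fin_supp a -> fin_supp b ->
  copy a (copy b f) = copy (bcat a b) f.
Proof.
  intros Ha Hb. apply copy_eq; [fs| |].
  - intro u. rewrite <- Phi_bcat, !copy_in by assumption. apply Phi_bcat.
  - intros x Hx. destruct (classic (inb a x)) as [[v ->]|Hx'].
    + rewrite copy_in by exact Ha. rewrite copy_out; auto.
      intro K. apply Hx, inb_bcat, K.
    + apply copy_out; assumption.
Qed.

Lemma conj_copy (a b : brick) (g k : El) : fin_supp a -> fin_supp b ->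
  (forall u, g (Phi a u) = Phi b u) -> g ** copy a k ** inv g = copy b k.
Proof.
  intros Ha Hb H. apply copy_eq; [exact Hb| |].
  - intro u. rewrite !mul_fw, <- H, inv_fw, copy_in by exact Ha. apply H.
  - intros x Hx. rewrite !mul_fw, copy_out, fw_inv; auto.
    intros [u Hu]. apply Hx. exists u. rewrite <- H, <- Hu. symmetry. apply fw_inv.
Qed.

(** * Supports *)

Definition supp (f : El) (A : X -> Prop) : Prop := forall x, ~ A x -> f x = x.

Lemma copy_supported (a : brick) (k : El) : fin_supp a -> supp (copy a k) (inb a).
Proof. intros Ha x. apply copy_out, Ha. Qed.

Lemma supp_stable (f : El) (A : X -> Prop) (x : X) : supp f A -> A x -> A (f x).
Proof.
  intros Hf Hx. apply NNPP. intro K. assert (E := Hf _ K). apply El_inj in E.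
  rewrite E in K. contradiction.
Qed.

Lemma supp_inv (f : El) (A : X -> Prop) : supp f A -> supp (inv f) A.
Proof. intros Hf x Hx. rewrite <- (Hf x Hx) at 1. apply inv_fw. Qed.

Lemma supp_mono (f : El) (A B : X -> Prop) : (forall x, A x -> B x) -> supp f A -> supp f B.
Proof. intros H Hf x Hx. apply Hf. auto. Qed.

Lemma supp_conj (f g : El) (A : X -> Prop) :
  supp f A -> supp (g ** f ** inv g) (fun x => A (inv g x)).
Proof. intros Hf x Hx. rewrite !mul_fw, (Hf _ Hx). apply fw_inv. Qed.

Lemma supp_commute (f g : El) (A B : X -> Prop) : supp f A -> supp g B ->
  (forall x, A x -> B x -> False) -> f ** g = g ** f.
Proof.
  intros Hf Hg D. apply El_ext. intro x. rewrite !mul_fw.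
  destruct (classic (A x)) as [Ax|Ax].
  - rewrite (Hg x), (Hg (f x)); [reflexivity| |].
    + intro K. apply (D (f x)); [apply (supp_stable f A); assumption|exact K].
    + intro K. apply (D x); assumption.
  - rewrite (Hf x Ax). destruct (classic (B x)) as [Bx|Bx].
    + apply Hf. intro K. apply (D (g x)); [exact K|apply (supp_stable g B); assumption].
    + rewrite (Hg x Bx). apply Hf, Ax.
Qed.

(** An element supported in a brick preserves that brick, so reading it through [Phi a] gives an
    element acting on the whole space. *)
Lemma supp_copy (a : brick) (f : El) : fin_supp a -> supp f (inb a) -> exists k, f = copy a k.
Proof.
  intros Ha Hf.
  assert (K : forall g : El, supp g (inb a) -> forall x, Phi a (unPhi a (g (Phi a x))) = g (Phi a x)).
  { intros g Hg x. apply Phi_unPhi, supp_stable; [exact Hg|apply inb_Phi]. }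
  set (h := fun x => unPhi a (f (Phi a x))). set (h' := fun x => unPhi a (inv f (Phi a x))).
  assert (E : forall x, mk h h' x = h x).
  { apply mk_fw.
    - intro x. unfold h, h'. rewrite K, inv_fw by exact Hf. apply unPhi_Phi.
    - intro x. unfold h, h'. rewrite K, fw_inv by apply supp_inv, Hf. apply unPhi_Phi.
    - apply (lpw_ext G (fun x => True /\ inb a (f (Phi a x))) _ (fun x => unPhi a (f (Phi a x))));
        [|auto|].
      + intro x. split; [auto|]. intros _. split; [exact I|].
        apply supp_stable; [exact Hf|apply inb_Phi].
      + apply (lpw_comp G HG _ (inb a) (fun x => f (Phi a x)) (unPhi a)).
        * apply (lpw_total_comp f (Phi a)); [apply fw_lpw|apply lpw_Phi, Ha].
        * apply lpw_unPhi, Ha. }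
  exists (mk h h'). apply copy_eq; [exact Ha| |exact Hf].
  intro u. rewrite E. symmetry. apply K, Hf.
Qed.

(** * Swaps of two bricks and of two clopen sets *)

Definition disj (a b : brick) : Prop := forall x, inb a x -> inb b x -> False.

Definition swf (a b : brick) (x : X) : X :=
  ifP (inb a x) (Phi b (unPhi a x)) (ifP (inb b x) (Phi a (unPhi b x)) x).

Definition sw (a b : brick) : El := mk (swf a b) (swf a b).

Lemma sw_fw (a b : brick) : fin_supp a -> fin_supp b -> disj a b ->
  (forall u, sw a b (Phi a u) = Phi b u) /\ (forall u, sw a b (Phi b u) = Phi a u) /\
  (forall x, ~ inb a x -> ~ inb b x -> sw a b x = x).
Proof.
  intros Ha Hb D.
  assert (Fa : forall u, swf a b (Phi a u) = Phi b u).
  { intro u. unfold swf. rewrite ifT by apply inb_Phi. rewrite unPhi_Phi. reflexivity. }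
  assert (Fb : forall u, swf a b (Phi b u) = Phi a u).
  { intro u. unfold swf. rewrite ifF by (intro K; apply (D _ K), inb_Phi).
    rewrite ifT by apply inb_Phi. rewrite unPhi_Phi. reflexivity. }
  assert (Fo : forall x, ~ inb a x -> ~ inb b x -> swf a b x = x).
  { intros x Hx Hx'. unfold swf. rewrite !ifF by assumption. reflexivity. }
  assert (I : forall x, swf a b (swf a b x) = x).
  { intro x. destruct (classic (inb a x)) as [[u ->]|Hx]; [rewrite Fa, Fb; reflexivity|].
    destruct (classic (inb b x)) as [[u ->]|Hx']; [rewrite Fb, Fa; reflexivity|].
    rewrite (Fo x), Fo; auto. }
  assert (E : forall x, sw a b x = swf a b x).
  { apply mk_fw; [exact I|exact I|].
    apply (lpw_glue G (fun x => inb a x \/ inb b x)).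
    - apply (lpw_union G); [apply (lpw_id_chart G HG a b)|apply (lpw_id_chart G HG b a)]; assumption.
    - apply (lpw_ext G (fun x => ~ inb a x /\ ~ inb b x) _ (fun x => x)); [tauto| |].
      + intros x [Hx Hx']. symmetry. apply Fo; assumption.
      + apply (opn_and G HG); apply (opn_not_brick G HG); assumption. }
  repeat split; intros; rewrite E; auto.
Qed.

Lemma sw_l (a b : brick) (u : X) : fin_supp a -> fin_supp b -> disj a b ->
  sw a b (Phi a u) = Phi b u.
Proof. intros Ha Hb D. apply (sw_fw a b Ha Hb D). Qed.

Lemma sw_r (a b : brick) (u : X) : fin_supp a -> fin_supp b -> disj a b ->
  sw a b (Phi b u) = Phi a u.
Proof. intros Ha Hb D. apply (sw_fw a b Ha Hb D). Qed.

Lemma sw_o (a b : brick) (x : X) : fin_supp a -> fin_supp b -> disj a b ->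
  ~ inb a x -> ~ inb b x -> sw a b x = x.
Proof. intros Ha Hb D. apply (sw_fw a b Ha Hb D). Qed.

Lemma sw_invol (a b : brick) : fin_supp a -> fin_supp b -> disj a b -> sw a b ** sw a b = one.
Proof.
  intros Ha Hb D. apply El_ext. intro x. rewrite mul_fw.
  destruct (classic (inb a x)) as [[u ->]|Hx]; [rewrite sw_l, sw_r; auto|].
  destruct (classic (inb b x)) as [[u ->]|Hx']; [rewrite sw_r, sw_l; auto|].
  rewrite !(sw_o _ _ x); auto.
Qed.

(** Swaps over general clopen sets are needed because conjugation does not keep bricks bricks, while
    this larger class is stable under it ([conj_ls]). The condition [U (inv h x)] says that [x] lies
    in the image of [U]. *)
Definition lsf (h : El) (U : X -> Prop) (x : X) : X :=
  ifP (U x) (h x) (ifP (U (inv h x)) (inv h x) x).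

Definition ls (h : El) (U : X -> Prop) : El := mk (lsf h U) (lsf h U).

Definition movable (h : El) (U : X -> Prop) : Prop :=
  clopen G U /\ forall x, U x -> ~ U (h x).

Lemma ls_fw (h : El) (U : X -> Prop) : movable h U ->
  (forall x, U x -> ls h U x = h x) /\ (forall x, U (inv h x) -> ls h U x = inv h x) /\
  (forall x, ~ U x -> ~ U (inv h x) -> ls h U x = x).
Proof.
  intros [C D].
  assert (F1 : forall x, U x -> lsf h U x = h x).
  { intros x Hx. unfold lsf. apply ifT, Hx. }
  assert (F2 : forall x, U (inv h x) -> lsf h U x = inv h x).
  { intros x Hx. unfold lsf. rewrite ifF; [apply ifT, Hx|].
    intro K. apply (D _ Hx). rewrite fw_inv. exact K. }
  assert (F3 : forall x, ~ U x -> ~ U (inv h x) -> lsf h U x = x).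
  { intros x Hx Hx'. unfold lsf. rewrite !ifF by assumption. reflexivity. }
  assert (I : forall x, lsf h U (lsf h U x) = x).
  { intro x. destruct (classic (U x)) as [Hx|Hx].
    - rewrite (F1 x Hx), F2; rewrite inv_fw; auto.
    - destruct (classic (U (inv h x))) as [Hx'|Hx'].
      + rewrite (F2 x Hx'), F1 by exact Hx'. apply fw_inv.
      + rewrite (F3 x), F3; auto. }
  assert (E : forall x, ls h U x = lsf h U x).
  { apply mk_fw; [exact I|exact I|]. unfold lsf.
    apply lpw_if; [exact C|apply fw_lpw|]. apply lpw_if; [|apply (fw_lpw (inv h))|apply (opn_True G HG)].
    apply (clopen_pre G HG U (inv h)); [apply fw_lpw|exact C]. }
  repeat split; intros; rewrite E; auto.
Qed.

Lemma ls_l (h : El) (U : X -> Prop) (x : X) : movable h U -> U x -> ls h U x = h x.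
Proof. intro M. apply (ls_fw h U M). Qed.
Lemma ls_r (h : El) (U : X -> Prop) (x : X) : movable h U -> U (inv h x) -> ls h U x = inv h x.
Proof. intro M. apply (ls_fw h U M). Qed.
Lemma ls_o (h : El) (U : X -> Prop) (x : X) :
  movable h U -> ~ U x -> ~ U (inv h x) -> ls h U x = x.
Proof. intro M. apply (ls_fw h U M). Qed.

Lemma ls_supp (h : El) (U : X -> Prop) : movable h U ->
  supp (ls h U) (fun x => U x \/ U (inv h x)).
Proof. intros M x Hx. apply ls_o; tauto. Qed.

Lemma ls_eq (h f : El) (U : X -> Prop) : movable h U ->
  (forall x, U x -> f x = h x) -> (forall x, U x -> f (h x) = x) ->
  (forall x, ~ U x -> ~ U (inv h x) -> f x = x) -> f = ls h U.
Proof.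
  intros M H1 H2 H3. apply El_ext. intro x. destruct (classic (U x)) as [Hx|Hx].
  - rewrite ls_l by assumption. auto.
  - destruct (classic (U (inv h x))) as [Hx'|Hx'].
    + rewrite ls_r by assumption. rewrite <- (fw_inv h x) at 1. auto.
    + rewrite ls_o by assumption. auto.
Qed.

Lemma ls_invol (h : El) (U : X -> Prop) : movable h U -> ls h U ** ls h U = one.
Proof.
  intro M. apply El_ext. intro x. rewrite mul_fw. destruct (classic (U x)) as [Hx|Hx].
  - rewrite (ls_l h U x) by assumption. rewrite ls_r; rewrite ?inv_fw; auto.
  - destruct (classic (U (inv h x))) as [Hx'|Hx'].
    + rewrite (ls_r h U x) by assumption. rewrite ls_l by assumption. apply fw_inv.
    + rewrite !(ls_o h U x) by assumption. reflexivity.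
Qed.

Lemma movable_conj (g h : El) (U : X -> Prop) : movable h U ->
  movable (g ** h ** inv g) (fun x => U (inv g x)).
Proof.
  intros [C D]. split.
  - apply (clopen_pre G HG U (inv g)); [apply fw_lpw|exact C].
  - intros x Hx. rewrite !mul_fw, inv_fw. apply D, Hx.
Qed.

Lemma conj_ls (g h : El) (U : X -> Prop) : movable h U ->
  g ** ls h U ** inv g = ls (g ** h ** inv g) (fun x => U (inv g x)).
Proof.
  intro M. apply ls_eq; [apply movable_conj, M| | |].
  - intros x Hx. rewrite !mul_fw, ls_l by assumption. reflexivity.
  - intros x Hx. rewrite !mul_fw, inv_fw, ls_r by (rewrite ?inv_fw; assumption).
    rewrite inv_fw. apply fw_inv.
  - intros x Hx Hx'. rewrite !mul_fw, ls_o; [apply fw_inv|exact M|exact Hx|].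
    intro K. apply Hx'. rewrite !invM, !mul_fw, invK, !inv_fw. exact K.
Qed.

Lemma movable_sub (h : El) (U V : X -> Prop) : movable h U -> clopen G V ->
  (forall x, V x -> U x) -> movable h V.
Proof.
  intros [C D] CV H. split; [exact CV|]. intros x Hx K. apply (D x); auto.
Qed.

Lemma sw_ls (a b : brick) : fin_supp a -> fin_supp b -> disj a b ->
  movable (sw a b) (inb a) /\ sw a b = ls (sw a b) (inb a).
Proof.
  intros Ha Hb D.
  assert (M : movable (sw a b) (inb a)).
  { split; [apply (clopen_brick G HG), Ha|]. intros x [u ->] K.
    rewrite sw_l in K by assumption. apply (D _ K), inb_Phi. }
  split; [exact M|]. apply ls_eq; [exact M|reflexivity| |].
  - intros x _. rewrite <- mul_fw, sw_invol by assumption. reflexivity.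
  - intros x Hx Hx'. apply sw_o; try assumption. intros [u ->]. apply Hx'.
    rewrite <- (sw_l a b u), inv_fw by assumption. apply inb_Phi.
Qed.

Definition res (f : El) (U : X -> Prop) : El :=
  mk (fun x => ifP (U x) (f x) x) (fun x => ifP (U x) (inv f x) x).

Lemma res_fw (f : El) (U : X -> Prop) (x : X) : clopen G U ->
  (forall x, U x <-> U (f x)) -> res f U x = ifP (U x) (f x) x.
Proof.
  intros C H. unfold res. rewrite mk_fw; [reflexivity| | |].
  - intro y. destruct (classic (U y)) as [Hy|Hy].
    + rewrite (ifT (U y)), ifT, inv_fw; auto. apply -> H. exact Hy.
    + rewrite (ifF (U y)), ifF; auto.
  - intro y. destruct (classic (U y)) as [Hy|Hy].
    + rewrite (ifT (U y)), ifT, fw_inv; auto. apply H. rewrite fw_inv. exact Hy.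
    + rewrite (ifF (U y)), ifF; auto.
  - apply lpw_if; [exact C|apply fw_lpw|apply (opn_True G HG)].
Qed.

Definition Sub (N : El -> Prop) : Prop :=
  N one /\ (forall f g, N f -> N g -> N (f ** g)) /\ (forall f, N f -> N (inv f)).

Definition Normal (N : El -> Prop) : Prop :=
  Sub N /\ forall g n, N n -> N (g ** n ** inv g).

Definition comm (f g : El) : El := f ** g ** inv f ** inv g.

End Group.

Arguments El {S} G.

Infix "**" := mul (at level 40, left associativity).

#[global] Hint Rewrite @mulA @mul1 @mulr1 @mulV @mulrV @mulVK @mulKV @invK @invM @inv1 : grp.
Ltac grp := autorewrite with grp; auto.

(** * Moving bricks *)

Section Moving.
Context {S : Type}.
Notation brick := (S -> list bool).
Notation X := (Config S).
Context {G : (S -> S) -> Prop} {HG : perm_group G}.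
Variable s0 : S.

Definition half0 : brick := single s0 [false].
Definition half1 : brick := single s0 [true].

Lemma halves_disj : disj half0 half1.
Proof. intros x [u ->] [v K]. symmetry in K. exact (Phi_single_disj _ _ _ K). Qed.

Lemma fin_half0 : fin_supp half0. Proof. apply fin_supp_single. Qed.
Lemma fin_half1 : fin_supp half1. Proof. apply fin_supp_single. Qed.

Definition proper (a : brick) : Prop := exists x, ~ inb a x.

Lemma proper_single (a : brick) (s : S) (b : bool) : proper (bcat a (single s [b])).
Proof.
  exists (Phi a (Phi (single s [negb b]) (fun _ _ => false))). intro K.
  apply inb_bcat, inb_single_bit in K. rewrite bit_Phi_single in K. destruct b; discriminate.
Qed.

Lemma proper_half0 : proper half0.
Proof. exact (proper_single root s0 false). Qed.

(** Only one half of a free brick is taken, so that a point outside all three bricks survives; the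
    swaps in [brick_move] have to miss a point. *)
Lemma free_brick (a b : brick) (x : X) : fin_supp a -> fin_supp b -> ~ inb a x -> ~ inb b x ->
  exists c, fin_supp c /\ disj c a /\ disj c b /\ exists y, ~ inb c y /\ ~ inb a y /\ ~ inb b y.
Proof.
  intros Ha Hb Hxa Hxb.
  destruct (opn_nbhd G (fun x => ~ inb a x /\ ~ inb b x) x) as (d & Hd & Hx & Hsub).
  { apply (opn_and G HG); apply (opn_not_brick G HG); assumption. }
  { auto. }
  exists (bcat d half0).
  assert (E : forall y, inb (bcat d half0) y -> inb d y) by (intro; apply inb_bcat_l).
  split; [apply fin_supp_bcat; [exact Hd|apply fin_half0]|].
  split; [intros y Hy K; exact (proj1 (Hsub y (E y Hy)) K)|].
  split; [intros y Hy K; exact (proj2 (Hsub y (E y Hy)) K)|].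
  exists (Phi d (Phi half1 x)). split.
  - rewrite inb_bcat. intro K. apply (halves_disj _ K), inb_Phi.
  - apply Hsub, inb_Phi.
Qed.

(** If [a] and [b] miss a common point, [a] is sent to [b] through a third brick disjoint from both.
    The predicate [P] is left open because movers are needed both in the whole group and inside a
    normal subgroup. *)
Lemma brick_move (P : El G -> Prop) :
  (forall f g, P f -> P g -> P (f ** g)) ->
  (forall a b, fin_supp a -> fin_supp b -> disj a b -> (exists x, ~ inb a x /\ ~ inb b x) ->
    P (sw a b)) ->
  forall a b, fin_supp a -> fin_supp b -> proper a -> proper b ->
  exists g, P g /\ forall u, g (Phi a u) = Phi b u.
Proof.
  intros Pm Psw.
  assert (Step : forall a b x, fin_supp a -> fin_supp b -> ~ inb a x -> ~ inb b x ->
    exists g, P g /\ forall u, g (Phi a u) = Phi b u).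
  { intros a b x Ha Hb Hxa Hxb.
    destruct (free_brick a b x) as (c & Hc & Da & Db & y & Yc & Ya & Yb); try assumption.
    assert (Da' : disj a c) by (intros z ? ?; apply (Da z); assumption).
    exists (sw c b ** sw a c). split.
    - apply Pm; apply Psw; try assumption; exists y; auto.
    - intro u. rewrite mul_fw, sw_l, sw_l by assumption. reflexivity. }
  intros a b Ha Hb [x Hx] [y Hy].
  destruct (classic (exists z, ~ inb a z /\ ~ inb b z)) as [[z [Hz Hz']]|K].
  - apply (Step a b z); assumption.
  (* Here [a] and [b] cover the space. A brick [c] disjoint from [a] serves as intermediate stop:
     [c] and [b] both miss [y], which lies in [a]. *)
  - destruct (free_brick a a x) as (c & Hc & Da & _ & z & Zc & Za & _); try assumption.
    assert (Ya : inb a y) by (apply NNPP; intro Q; apply K; exists y; auto).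
    destruct (Step c b y) as (g & Pg & Hg); try assumption.
    { intro Q. apply (Da y); assumption. }
    assert (Da' : disj a c) by (intros t ? ?; apply (Da t); assumption).
    exists (g ** sw a c). split.
    + apply Pm; [exact Pg|]. apply Psw; try assumption. exists z. auto.
    + intro u. rewrite mul_fw, sw_l by assumption. apply Hg.
Qed.

(** [gc] maps the first half of the space into [c], so its inverse puts [A] into the second half;
    the swap of the halves and [gb] then bring it into [b]. The extra letter in [bcat a half0] makes
    the target of the mover proper. *)
Lemma flexible (A : X -> Prop) (b c : brick) : fin_supp b -> fin_supp c ->
  (forall x, inb c x -> ~ A x) -> exists g : El G, forall x, A x -> inb b (g x).
Proof.
  intros Hb Hc D.
  assert (M : forall a : brick, fin_supp a ->
    exists g : El G, forall u, g (Phi half0 u) = Phi (bcat a half0) u).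
  { intros a Ha. destruct (brick_move (fun _ => True)) with (a := half0) (b := bcat a half0)
      as (g & _ & Hg); auto.
    - apply fin_half0.
    - apply fin_supp_bcat; [exact Ha|apply fin_half0].
    - apply proper_half0.
    - apply proper_single.
    - exists g. exact Hg. }
  destruct (M b Hb) as [gb Hgb]. destruct (M c Hc) as [gc Hgc].
  exists (gb ** sw half0 half1 ** inv gc). intros x Hx. rewrite !mul_fw.
  destruct (split_bit s0 (inv gc x)) as ([] & u & E).
  - rewrite E. change (single s0 [true]) with half1.
    rewrite sw_r, Hgb by auto using fin_half0, fin_half1, halves_disj.
    apply (inb_bcat_l b half0), inb_Phi.
  - exfalso. apply (D x); [|exact Hx]. rewrite <- (fw_inv gc x), E.
    change (single s0 [false]) with half0. rewrite Hgc. apply (inb_bcat_l c half0), inb_Phi.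
Qed.

(** * Flipping one bit *)

Definition bitflip (d : nat) (x : X) : X :=
  fun t i => ifP (t = s0 /\ i = d) (negb (x t i)) (x t i).

Lemma bitflip_bit (d : nat) (x : X) : bitflip d x s0 d = negb (x s0 d).
Proof. unfold bitflip. rewrite ifT; auto. Qed.

Lemma bitflip_other (d : nat) (x : X) (t : S) (i : nat) :
  t <> s0 \/ i <> d -> bitflip d x t i = x t i.
Proof. intro H. unfold bitflip. rewrite ifF; tauto. Qed.

Lemma Phi_single_bits (s t : S) (b : bool) (u : X) (i : nat) :
  Phi (single s [b]) u t i = ifP (t = s) (match i with 0 => b | Datatypes.S j => u t j end) (u t i).
Proof.
  unfold Phi, single. destruct (eqS t s) as [->|H].
  - rewrite ifT by reflexivity. destruct i as [|i]; [reflexivity|].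
    rewrite wcat_cons_S, wcat_nil. reflexivity.
  - rewrite ifF by exact H. rewrite wcat_nil. reflexivity.
Qed.

Lemma bitflip_0 (b : bool) (u : X) :
  bitflip 0 (Phi (single s0 [b]) u) = Phi (single s0 [negb b]) u.
Proof.
  extensionality t. extensionality i. unfold bitflip. rewrite !Phi_single_bits.
  destruct (classic (t = s0)) as [->|Ht].
  - rewrite !(ifT (s0 = s0)) by reflexivity. destruct i as [|i].
    + rewrite ifT; auto.
    + rewrite ifF; [reflexivity|]. intros [_ K]. discriminate.
  - rewrite !(ifF (t = s0)) by exact Ht. rewrite ifF; tauto.
Qed.

Lemma bitflip_S (d : nat) (b : bool) (u : X) :
  bitflip (Datatypes.S d) (Phi (single s0 [b]) u) = Phi (single s0 [b]) (bitflip d u).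
Proof.
  extensionality t. extensionality i. unfold bitflip. rewrite !Phi_single_bits.
  destruct (classic (t = s0)) as [->|Ht].
  - rewrite !(ifT (s0 = s0)) by reflexivity. destruct i as [|i].
    + rewrite ifF; [reflexivity|]. intros [_ K]. discriminate.
    + destruct (Nat.eq_dec i d) as [->|Hi].
      * rewrite !ifT; auto.
      * rewrite !ifF; auto; intros [_ K]; [apply Hi, K|apply Hi; congruence].
  - rewrite !(ifF (t = s0)) by exact Ht. rewrite !ifF; tauto.
Qed.

(** Built from copies of a swap, so that no further charts are needed to have it in the group;
    [flip_fw] identifies it with [bitflip]. *)
Fixpoint flip (d : nat) : El G :=
  match d with
  | 0 => sw half0 half1
  | Datatypes.S d => copy half0 (flip d) ** copy half1 (flip d)
  end.

Lemma copy_halves (k : El G) (s : S) (b : bool) (u : X) :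
  (copy (single s [false]) k ** copy (single s [true]) k) (Phi (single s [b]) u) =
  Phi (single s [b]) (k u).
Proof.
  rewrite mul_fw. destruct b.
  - rewrite copy_in by fs. apply copy_out; [fs|]. intros [v K]. exact (Phi_single_disj _ _ _ K).
  - rewrite (copy_out (single s [true])); [apply copy_in; fs|fs|].
    intros [v K]. symmetry in K. exact (Phi_single_disj _ _ _ K).
Qed.

Lemma flip_fw (d : nat) (x : X) : flip d x = bitflip d x.
Proof.
  revert x. induction d as [|d IH]; intro x; destruct (split_bit s0 x) as (b & u & ->).
  - rewrite bitflip_0. destruct b; cbn [flip negb].
    + apply sw_r; auto using fin_half0, fin_half1, halves_disj.
    + apply sw_l; auto using fin_half0, fin_half1, halves_disj.
  - rewrite bitflip_S, <- IH. apply copy_halves.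
Qed.

Lemma bitflip_invol (d : nat) (x : X) : bitflip d (bitflip d x) = x.
Proof.
  extensionality t. extensionality i. destruct (classic (t = s0 /\ i = d)) as [[-> ->]|H].
  - rewrite !bitflip_bit. apply Bool.negb_involutive.
  - rewrite !bitflip_other; tauto.
Qed.

(** A finite union of bricks is described by words of bounded length, and flipping a bit beyond that
    bound does not leave any of the bricks. *)
Lemma opn_bitflip (A : X -> Prop) : opn G A -> exists d, forall x, A x -> A (bitflip d x).
Proof.
  intros [l Hl]. destruct (chart_list_depth G l) as (F & d & H). exists d. intros x Hx.
  destruct (Hl x Hx) as (c & Hc & V & Hd & Hu).
  assert (K : inb (dom c) (bitflip d x)).
  { apply in_brick_inb. intros s i Hi. destruct (H c Hc V s) as [Hs _].
    rewrite bitflip_other by (right; lia). apply in_brick_inb in Hd. apply Hd, Hi. }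
  destruct K as [v ->]. apply Hu.
Qed.

Lemma opn_bit (s : S) (d : nat) (v : bool) : opn G (fun x : X => x s d = v).
Proof.
  revert v. induction d as [|d IH]; intro v.
  - apply (opn_ext G (inb (single s [v]))); [intro; apply inb_single_bit|].
    apply (opn_brick G HG). fs.
  - assert (K : forall b, opn G (fun x : X => inb (single s [b]) x /\
      unPhi (single s [b]) x s d = v)).
    { intro b. apply (opn_pre G HG (inb (single s [b])) (fun x => x s d = v)
        (unPhi (single s [b]))); [|apply IH]. apply lpw_unPhi. fs. }
    apply (opn_ext G _ _) with (2 := opn_or G _ _ (K true) (K false)).
    intro x. destruct (split_bit s x) as (b & u & ->).
    rewrite Phi_single_bits, ifT by reflexivity. rewrite !inb_single_bit, bit_Phi_single.
    destruct b; rewrite unPhi_Phi; split; intuition discriminate.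
Qed.

Lemma clopen_bit (s : S) (d : nat) (v : bool) : clopen G (fun x : X => x s d = v).
Proof.
  split; [apply opn_bit|]. apply (opn_ext G (fun x => x s d = negb v)); [|apply opn_bit].
  intro x. destruct (x s d), v; simpl; split; congruence.
Qed.

(** Some bit differs at [x] and [n x]. On a small brick around [x] both this bit and its value after
    [n] are constant, and the two constants differ. *)
Lemma moved_brick (n : El G) (x : X) : n x <> x ->
  exists b, fin_supp b /\ inb b x /\ forall y, inb b y -> ~ inb b (n y).
Proof.
  intro H.
  assert (E : exists s i, n x s i <> x s i).
  { apply NNPP. intro K. apply H. extensionality s. extensionality i.
    apply NNPP. intro Q. apply K. exists s, i. exact Q. }
  destruct E as (s & i & E).
  destruct (opn_nbhd G (fun y => y s i = x s i /\ (True /\ n y s i = n x s i)) x)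
    as (b & Hb & Hx & Hsub); [|auto|].
  - apply (opn_and G HG); [apply opn_bit|].
    apply (opn_pre G HG _ (fun y => y s i = n x s i)); [apply fw_lpw|apply opn_bit].
  - exists b. split; [exact Hb|]. split; [exact Hx|]. intros y Hy K.
    destruct (Hsub _ Hy) as (_ & _ & E1). destruct (Hsub _ K) as (E2 & _). congruence.
Qed.

End Moving.

(** * Consequences of normality *)

Section Normality.
Context {S : Type}.
Notation brick := (S -> list bool).
Notation X := (Config S).
Context {G : (S -> S) -> Prop} {HG : perm_group G}.
Variable s0 : S.
Variable N : El G -> Prop.
Hypothesis NN : Normal N.

Lemma N1 : N one. Proof. apply NN. Qed.
Lemma NM (f g : El G) : N f -> N g -> N (f ** g). Proof. apply NN. Qed.
Lemma NV (f : El G) : N f -> N (inv f). Proof. apply NN. Qed.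
Lemma NJ (g n : El G) : N n -> N (g ** n ** inv g). Proof. apply NN. Qed.

Lemma NJ_iff (g n : El G) : N (g ** n ** inv g) -> N n.
Proof.
  intro H. replace n with (inv g ** (g ** n ** inv g) ** inv (inv g)); [apply NJ, H|]. grp.
Qed.

Lemma NMl (f g : El G) : N f -> N (f ** g) -> N g.
Proof. intros Hf H. rewrite <- (mulVK f g). apply NM; [apply NV, Hf|exact H]. Qed.

Lemma NMr (f g : El G) : N g -> N (f ** g) -> N f.
Proof.
  intros Hg H. replace f with (f ** g ** inv g) by grp. apply NM; [exact H|apply NV, Hg].
Qed.

(* In the quotient by [N] the hypothesis reads h = h h. *)
Lemma N_square (h n1 g1 g2 n2 : El G) : N n1 -> N g1 -> N g2 -> N n2 ->
  h = n1 ** (g1 ** h ** inv g1) ** (g2 ** h ** inv g2) ** n2 -> N h.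
Proof.
  intros H1 K1 K2 H2 E.
  assert (C : forall g, N g -> exists m, N m /\ g ** h ** inv g = h ** m).
  { intros g Hg. exists (inv h ** g ** h ** inv g). split; [|grp].
    apply NM; [|apply NV, Hg]. rewrite <- (invK h) at 2. apply NJ, Hg. }
  destruct (C g1 K1) as (m1 & M1 & E1). destruct (C g2 K2) as (m2 & M2 & E2).
  rewrite E1, E2 in E.
  assert (F : one = (inv h ** n1 ** inv (inv h)) ** m1 ** h ** (m2 ** n2)).
  { replace one with (inv h ** h) by grp. rewrite E at 2. grp. }
  apply (NMr h (m2 ** n2)); [apply NM; assumption|].
  apply (NMl ((inv h ** n1 ** inv (inv h)) ** m1)); [apply NM; [apply NJ|]; assumption|].
  rewrite <- mulA, <- F. apply N1.
Qed.

Variable n : El G.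
Hypothesis Nn : N n.
Variable x0 : X.
Hypothesis Hn : n x0 <> x0.

Lemma comm_brick_in_N (b : brick) (f g : El G) : (forall y, inb b y -> ~ inb b (n y)) ->
  supp f (inb b) -> supp g (inb b) -> N (comm f g).
Proof.
  intros Hb Hf Hg.
  (* [c] lives on the image of [b] under [n], away from the support of [g], and [f ** c] is the
     commutator of [f] and [n], which lies in [N]. *)
  set (c := n ** inv f ** inv n).
  assert (C : c ** g = g ** c).
  { apply (supp_commute _ _ (fun x => inb b (inv n x)) (inb b)).
    - apply supp_conj, supp_inv, Hf.
    - exact Hg.
    - intros x K L. apply (Hb _ K). rewrite fw_inv. exact L. }
  assert (E : comm f g = (f ** n ** inv f ** inv n) **
      (g ** inv (f ** n ** inv f ** inv n) ** inv g)).
  { replace (f ** n ** inv f ** inv n) with (f ** c) by (unfold c; grp).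
    unfold comm. rewrite invM.
    transitivity (f ** (g ** c) ** inv c ** inv f ** inv g); [grp|]. rewrite <- C. grp. }
  assert (K : N (f ** n ** inv f ** inv n)) by (apply NM; [apply NJ|apply NV]; exact Nn).
  rewrite E. apply NM; [exact K|apply NJ, NV, K].
Qed.

Lemma comm_in_N (A : X -> Prop) (c : brick) (f g : El G) : fin_supp c ->
  (forall x, inb c x -> ~ A x) -> supp f A -> supp g A -> N (comm f g).
Proof.
  intros Hc D Hf Hg. destruct (moved_brick n x0 Hn) as (b & Hb & _ & Mb).
  destruct (flexible s0 A b c Hb Hc D) as [t Ht].
  apply (NJ_iff t).
  replace (t ** comm f g ** inv t) with (comm (t ** f ** inv t) (t ** g ** inv t))
    by (unfold comm; grp).
  apply (comm_brick_in_N b); [exact Mb| |];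
    apply (supp_mono _ (fun x => A (inv t x)));
    try (apply supp_conj; assumption);
    intros x Hx; rewrite <- (fw_inv t x); apply Ht, Hx.
Qed.

(* [ls h U] is the product of two commuting swaps, over the two halves of [U]
   given by a deep bit; they are conjugate by the flip of that bit. *)
Lemma ls_comm (h : El G) (U : X -> Prop) : movable h U ->
  exists t k, ls h U = comm t k /\ t ** t = one /\ k ** k = one /\
    supp t (fun x => U x \/ U (inv h x)) /\ supp k (fun x => U x \/ U (inv h x)).
Proof.
  intros M. pose proof M as [C D].
  destruct (opn_bitflip s0 U (proj1 C)) as [d Hd].
  set (p := bitflip s0 d).
  assert (pp : forall x, p (p x) = x) by apply bitflip_invol.
  assert (HUp : forall x, U x <-> U (flip s0 d x)).
  { intro x. rewrite flip_fw. split; [apply Hd|]. intro K. apply Hd in K.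
    rewrite bitflip_invol in K. exact K. }
  set (V := fun x => U x /\ x s0 d = false).
  assert (MV : movable h V).
  { apply (movable_sub h U); [exact M| |intros x [K _]; exact K].
    apply (clopen_and G HG); [exact C|apply clopen_bit]. }
  set (t := ls h V). set (f := res (flip s0 d) U).
  assert (fU : forall x, U x -> f x = p x).
  { intros x Hx. unfold f. rewrite res_fw by assumption. rewrite ifT by exact Hx. apply flip_fw. }
  assert (fO : forall x, ~ U x -> f x = x).
  { intros x Hx. unfold f. rewrite res_fw by assumption. apply ifF, Hx. }
  (* [k] flips the bit on [U] and, carried over by [h], on the image of [U]; conjugation by [k]
     therefore exchanges the swaps over the two halves of [U]. *)
  set (k := f ** (h ** f ** inv h)).
  assert (D' : forall x, U x -> ~ U (inv h x)).
  { intros x Hx K. apply (D _ K). rewrite fw_inv. exact Hx. }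
  assert (k1 : forall x, U x -> k x = p x).
  { intros x Hx. unfold k. rewrite !mul_fw, (fO (inv h x)), fw_inv by (apply D', Hx). auto. }
  assert (k2 : forall x, U x -> k (h x) = h (p x)).
  { intros x Hx. unfold k. rewrite !mul_fw, inv_fw, (fU x Hx). apply fO, D, Hd, Hx. }
  assert (k3 : forall x, ~ U x -> ~ U (inv h x) -> k x = x).
  { intros x Hx Hx'. unfold k. rewrite !mul_fw, (fO _ Hx'), fw_inv. auto. }
  assert (kk : k ** k = one).
  { apply El_ext. intro x. rewrite mul_fw. destruct (classic (U x)) as [Hx|Hx].
    - rewrite (k1 x Hx), k1 by apply Hd, Hx. apply pp.
    - destruct (classic (U (inv h x))) as [Hx'|Hx'].
      + assert (E : x = h (inv h x)) by (symmetry; apply fw_inv).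
        rewrite E at 1. rewrite (k2 _ Hx'), k2, pp by apply Hd, Hx'. apply fw_inv.
      + rewrite (k3 x Hx Hx'). exact (k3 x Hx Hx'). }
  exists t, k. split; [|split; [|split; [|split]]].
  - symmetry. unfold comm. rewrite (inv_unique k k kk), (inv_unique t t (ls_invol h V MV)).
    assert (p1 : forall x, x s0 d = false -> p x s0 d = true).
    { intros x Hx. unfold p. rewrite bitflip_bit, Hx. reflexivity. }
    assert (p2 : forall x, x s0 d = true -> p x s0 d = false).
    { intros x Hx. unfold p. rewrite bitflip_bit, Hx. reflexivity. }
    assert (t0 : forall x, U x -> x s0 d = true -> t x = x).
    { intros x Hx Hb. apply ls_o; [exact MV| |]; intros [K1 K2]; [congruence|].
      apply (D' x); assumption. }
    assert (t0' : forall x, U x -> x s0 d = true -> t (h x) = h x).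
    { intros x Hx Hb. apply ls_o; [exact MV| |]; intros [K1 K2]; [apply (D x); assumption|].
      rewrite inv_fw in K2. congruence. }
    assert (t1 : forall x, U x -> x s0 d = false -> t x = h x).
    { intros x Hx Hb. apply ls_l; [exact MV|]. split; assumption. }
    assert (t1' : forall x, U x -> x s0 d = false -> t (h x) = x).
    { intros x Hx Hb. unfold t. rewrite ls_r; [apply inv_fw|exact MV|].
      rewrite inv_fw. split; assumption. }
    apply ls_eq; [exact M| | |].
    + intros x Hx. assert (Hpx := Hd x Hx). rewrite !mul_fw, (k1 x Hx).
      destruct (x s0 d) eqn:Hb.
      * rewrite (t1 (p x)), (k2 (p x)), pp, (t0' x); auto.
      * rewrite (t0 (p x)), (k1 (p x)), pp, (t1 x); auto.
    + intros x Hx. assert (Hpx := Hd x Hx). rewrite !mul_fw, (k2 x Hx).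
      destruct (x s0 d) eqn:Hb.
      * rewrite (t1' (p x)), (k1 (p x)), pp, (t0 x); auto.
      * rewrite (t0' (p x)), (k2 (p x)), pp, (t1' x); auto.
    + intros x Hx Hx'. assert (Tx : t x = x) by (apply ls_o; [exact MV| |]; intros [K _]; auto).
      rewrite !mul_fw, (k3 x Hx Hx'), Tx, (k3 x Hx Hx'). exact Tx.
  - apply ls_invol, MV.
  - exact kk.
  - apply (supp_mono _ (fun x => V x \/ V (inv h x))); [|apply ls_supp, MV].
    intros x [[K _]|[K _]]; auto.
  - intros x Hx. apply k3; tauto.
Qed.

Lemma ls_in_N (h : El G) (U : X -> Prop) (x : X) : movable h U ->
  ~ U x -> ~ U (inv h x) -> N (ls h U).
Proof.
  intros M Hx Hx'. destruct (ls_comm h U M) as (t & k & -> & _ & _ & St & Sk).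
  destruct M as [[_ C] _].
  destruct (opn_nbhd G (fun x => ~ U x /\ (True /\ ~ U (inv h x))) x) as (c & Hc & _ & Hsub).
  { apply (opn_and G HG); [exact C|].
    apply (opn_pre G HG _ (fun x => ~ U x) (inv h)); [apply fw_lpw|exact C]. }
  { auto. }
  apply (comm_in_N _ c t k Hc) with (2 := St) (3 := Sk).
  intros y Hy. destruct (Hsub y Hy) as (H1 & _ & H2). tauto.
Qed.

End Normality.

Arguments N1 {S G HG N} NN.
Arguments NM {S G HG N} NN.
Arguments NV {S G HG N} NN.
Arguments NJ {S G HG N} NN.
Arguments NJ_iff {S G HG N} NN.
Arguments NMl {S G HG N} NN.
Arguments NMr {S G HG N} NN.

(** * Normal subgroups containing the swaps *)

Section Swaps.
Context {S : Type}.
Notation brick := (S -> list bool).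
Notation X := (Config S).
Context {G : (S -> S) -> Prop} {HG : perm_group G}.
Variable s0 : S.
Variable N : El G -> Prop.
Hypothesis NN : Normal N.
Hypothesis Nls : forall (h : El G) (U : X -> Prop) (x : X),
  movable h U -> ~ U x -> ~ U (inv h x) -> N (ls h U).

Lemma sw_in_N (a b : brick) : fin_supp a -> fin_supp b -> disj a b ->
  (exists x, ~ inb a x /\ ~ inb b x) -> N (sw a b).
Proof.
  intros Ha Hb D (x & Hxa & Hxb). destruct (sw_ls (G := G) a b Ha Hb D) as [M ->].
  apply (Nls _ _ x); [exact M|exact Hxa|]. intros [u K].
  apply Hxb. exists u. rewrite <- (sw_l (G := G) a b u) by assumption.
  rewrite <- K. symmetry. apply fw_inv.
Qed.

Lemma move_in_N (a b : brick) : fin_supp a -> fin_supp b -> proper a -> proper b ->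
  exists g, N g /\ forall u, g (Phi a u) = Phi b u.
Proof. apply (brick_move s0 N); [exact (NM NN)|exact sw_in_N]. Qed.

Lemma copy_conj_N (k : El G) (a b : brick) : fin_supp a -> fin_supp b -> proper a -> proper b ->
  exists g, N g /\ copy b k = g ** copy a k ** inv g.
Proof.
  intros Ha Hb Pa Pb. destruct (move_in_N a b Ha Hb Pa Pb) as (g & Hg & E).
  exists g. split; [exact Hg|]. symmetry. apply conj_copy; assumption.
Qed.

(** Modulo [N] the three copies have the same class, so this class equals its own square. *)
Lemma copy_square (k m m' : El G) (a b c : brick) :
  fin_supp a -> fin_supp b -> fin_supp c -> proper a -> proper b -> proper c ->
  N m -> N m' -> copy a k = m ** copy b k ** copy c k ** m' -> N (copy a k).
Proof.
  intros Ha Hb Hc Pa Pb Pc Hm Hm' E.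
  destruct (copy_conj_N k a b Ha Hb Pa Pb) as (g & Hg & Eb).
  destruct (copy_conj_N k a c Ha Hc Pa Pc) as (g' & Hg' & Ec).
  rewrite Eb, Ec in E. exact (N_square N NN _ _ _ _ _ Hm Hg Hg' Hm' E).
Qed.

Lemma copy_sw (c a b : brick) : fin_supp c -> fin_supp a -> fin_supp b -> disj a b ->
  copy c (sw a b) = sw (bcat c a) (bcat c b) :> El G.
Proof.
  intros Hc Ha Hb D.
  assert (D' : disj (bcat c a) (bcat c b)).
  { intros x [u ->] K. rewrite <- Phi_bcat in K. rewrite inb_bcat in K.
    apply (D _ (inb_Phi a u) K). }
  symmetry. apply copy_eq; [exact Hc| |].
  - intro u. destruct (classic (inb a u)) as [[v ->]|Hu].
    + rewrite Phi_bcat, !sw_l by fs. symmetry. apply Phi_bcat.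
    + destruct (classic (inb b u)) as [[v ->]|Hu'].
      * rewrite Phi_bcat, !sw_r by fs. symmetry. apply Phi_bcat.
      * rewrite (sw_o a b u), sw_o; fs; rewrite inb_bcat; assumption.
  - intros x Hx. apply sw_o; fs; intro K; apply Hx; eapply inb_bcat_l; exact K.
Qed.

(** Quantifying over all bricks, [root] included, gives a property stable under products, inverses
    and further copies, as the recursive constructions below require. *)
Definition Nloc (k : El G) : Prop := forall a, fin_supp a -> N (copy a k).

Lemma Nloc_one : Nloc one.
Proof. intros a Ha. rewrite copy_one by exact Ha. apply (N1 NN). Qed.

Lemma Nloc_mul (f g : El G) : Nloc f -> Nloc g -> Nloc (f ** g).
Proof. intros Hf Hg a Ha. rewrite <- copy_mul by exact Ha. apply (NM NN); auto. Qed.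

Lemma Nloc_inv (f : El G) : Nloc f -> Nloc (inv f).
Proof. intros Hf a Ha. rewrite <- copy_inv by exact Ha. apply (NV NN); auto. Qed.

Lemma Nloc_copy (b : brick) (f : El G) : fin_supp b -> Nloc f -> Nloc (copy b f).
Proof. intros Hb Hf a Ha. rewrite copy_copy by assumption. apply Hf. fs. Qed.

Lemma Nloc_sw (a b : brick) : fin_supp a -> fin_supp b -> disj a b ->
  (exists x, ~ inb a x /\ ~ inb b x) -> Nloc (sw a b).
Proof.
  intros Ha Hb D (x & Hxa & Hxb) c Hc. rewrite copy_sw by assumption. apply sw_in_N; fs.
  - intros y [u ->] K. rewrite <- Phi_bcat in K. rewrite inb_bcat in K.
    apply (D _ (inb_Phi a u) K).
  - exists (Phi c x). rewrite !inb_bcat. auto.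
Qed.

(** * Moving the first letter to another coordinate *)

Definition betaf (s t : S) (x : X) : X :=
  Phi (single t [x s 0]) (unPhi (single s [true]) x).

(** For distinct [s] and [t] this is the baker's map of the two-dimensional Brin-Thompson group,
    acting on these two coordinates. *)
Definition beta (s t : S) : El G := mk (betaf s t) (betaf t s).

Lemma betaf_eq (s t : S) (b : bool) (u : X) :
  betaf s t (Phi (single s [b]) u) = Phi (single t [b]) u.
Proof.
  (* [unPhi] depends only on the lengths of the words, so [single s [true]] strips the first letter
     whatever it is. *)
  unfold betaf. rewrite bit_Phi_single. f_equal.
  rewrite <- (unPhi_Phi (single s [b]) u) at 2. extensionality r. unfold unPhi, single.
  destruct (eqS r s); reflexivity.
Qed.

Lemma beta_eq (s t : S) (b : bool) (u : X) :
  beta s t (Phi (single s [b]) u) = Phi (single t [b]) u.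
Proof.
  unfold beta. rewrite mk_fw; [apply betaf_eq| | |].
  - intro x. destruct (split_bit s x) as (c & v & ->). rewrite !betaf_eq. reflexivity.
  - intro x. destruct (split_bit t x) as (c & v & ->). rewrite !betaf_eq. reflexivity.
  - apply (lpw_ext G (fun x => inb (single s [true]) x \/ inb (single s [false]) x) _
      (betaf s t)); [|auto|].
    + intro x. split; [auto|]. intros _. destruct (split_bit s x) as ([] & v & ->); [left|right];
        apply inb_Phi.
    + apply (lpw_union G).
      * apply (lpw_id_chart G HG _ (single t [true])); fs; apply betaf_eq.
      * apply (lpw_id_chart G HG _ (single t [false])); fs; apply betaf_eq.
Qed.

Lemma mixed_disj (s t : S) :
  disj (bcat (single s [false]) (single t [true])) (bcat (single s [true]) (single t [false])).
Proof.
  intros x K L. apply inb_bcat_l in K, L. rewrite inb_single_bit in K, L. congruence.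
Qed.

(** Let the first letters be [i] at [s] and [j] at [t]. The swap exchanges them; what remains is to
    move [j] from [s] to the place behind [i] at [t], which is the same map one level deeper. So
    [beta] is two copies of itself up to a swap, the shape that [copy_square] asks for. *)
Lemma beta_split (s t : S) : s <> t ->
  beta s t = copy (single t [false]) (beta s t) ** copy (single t [true]) (beta s t) **
    sw (bcat (single s [false]) (single t [true])) (bcat (single s [true]) (single t [false])).
Proof.
  intro Hst. apply El_ext. intro x.
  destruct (split_bit s x) as (i & y & ->). destruct (split_bit t y) as (j & u & ->).
  rewrite mul_fw.
  assert (E : sw (G := G) (bcat (single s [false]) (single t [true]))
      (bcat (single s [true]) (single t [false]))
      (Phi (single s [i]) (Phi (single t [j]) u)) = Phi (single t [i]) (Phi (single s [j]) u)).
  { rewrite <- (Phi_single_comm s t) by exact Hst.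
    destruct i, j.
    - apply sw_o; fs; [apply mixed_disj| |]; rewrite Phi_bcat.
      + intro K. apply inb_bcat_l in K. rewrite <- Phi_bcat, inb_single_bit, bit_Phi_single in K.
        discriminate.
      + rewrite <- Phi_bcat, inb_bcat, inb_single_bit, bit_Phi_single. discriminate.
    - rewrite !Phi_bcat. apply sw_r; fs. apply mixed_disj.
    - rewrite !Phi_bcat. apply sw_l; fs. apply mixed_disj.
    - apply sw_o; fs; [apply mixed_disj| |]; rewrite Phi_bcat.
      + rewrite <- Phi_bcat, inb_bcat, inb_single_bit, bit_Phi_single. discriminate.
      + intro K. apply inb_bcat_l in K. rewrite <- Phi_bcat, inb_single_bit, bit_Phi_single in K.
        discriminate. }
  rewrite E, copy_halves, !beta_eq. reflexivity.
Qed.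

(** On proper bricks [copy_square] applies to the self-similar formula of [beta_split]. The same
    formula then expresses a copy on any brick, [root] included, through copies on proper ones. *)
Lemma Nloc_beta (s t : S) : Nloc (beta s t).
Proof.
  destruct (classic (s = t)) as [->|Hst].
  { replace (beta t t) with (one (G := G)); [apply Nloc_one|]. apply El_ext. intro x.
    destruct (split_bit t x) as (b & u & ->). symmetry. apply beta_eq. }
  set (w := sw (G := G) (bcat (single s [false]) (single t [true]))
    (bcat (single s [true]) (single t [false]))).
  assert (Hw : Nloc w).
  { apply Nloc_sw; fs; [apply mixed_disj|].
    exists (Phi (single s [false]) (Phi (single t [false]) (fun _ _ => false))). split.
    - rewrite inb_bcat, inb_single_bit, bit_Phi_single. discriminate.
    - intro K. apply inb_bcat_l in K. rewrite inb_single_bit, bit_Phi_single in K. discriminate. }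
  assert (E : forall a, fin_supp a -> copy a (beta s t) =
    one ** copy (bcat a (single t [false])) (beta s t) **
    copy (bcat a (single t [true])) (beta s t) ** copy a w).
  { intros a Ha. rewrite (beta_split s t Hst) at 1. rewrite mul1.
    rewrite <- !copy_mul, !copy_copy by fs. reflexivity. }
  assert (P : forall a, fin_supp a -> proper a -> N (copy a (beta s t))).
  { intros a Ha Pa. apply (copy_square (beta s t) one (copy a w) a
      (bcat a (single t [false])) (bcat a (single t [true]))); fs;
      try apply proper_single; try apply (N1 NN). }
  intros a Ha. rewrite E by exact Ha. repeat apply (NM NN); auto; try apply (N1 NN);
    apply P; fs; apply proper_single.
Qed.

(** * Moving the first letter to a deeper position *)

Definition cins (r : nat) (j : bool) (x : Cantor) : Cantor :=
  fun i => if i <? r then x i else if i =? r then j else x (i - 1).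

Lemma cins_0 (j : bool) (x : Cantor) : cins 0 j x = wcat [j] x.
Proof.
  extensionality i. destruct i as [|i]; [reflexivity|].
  rewrite wcat_cons_S, wcat_nil. unfold cins. simpl. f_equal. lia.
Qed.

Lemma cins_cons (r : nat) (j c : bool) (w : list bool) (x : Cantor) :
  cins (Datatypes.S r) j (wcat (c :: w) x) = wcat [c] (cins r j (wcat w x)).
Proof.
  extensionality i. destruct i as [|i]; [reflexivity|].
  rewrite wcat_cons_S, wcat_nil. unfold cins.
  change (Datatypes.S i <? Datatypes.S r) with (i <? r).
  change (Datatypes.S i =? Datatypes.S r) with (i =? r).
  destruct (Nat.ltb_spec i r); [reflexivity|]. destruct (Nat.eqb_spec i r); [reflexivity|].
  destruct i as [|i]; [lia|]. simpl. rewrite Nat.sub_0_r. reflexivity.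
Qed.

Lemma cins_wcat (r : nat) (j : bool) (w : list bool) (x : Cantor) :
  cins (length w + r) j (wcat w x) = wcat w (cins r j x).
Proof.
  induction w as [|c w IH]; [rewrite !wcat_nil; reflexivity|].
  cbn [length Nat.add]. rewrite cins_cons, IH. apply wcat_app.
Qed.

Definition ins (s : S) (r : nat) (j : bool) (x : X) : X :=
  fun t => if eqS t s then cins r j (x t) else x t.

Lemma ins_0 (s : S) (j : bool) (x : X) : ins s 0 j x = Phi (single s [j]) x.
Proof.
  extensionality t. unfold ins, Phi, single. destruct (eqS t s).
  - apply cins_0.
  - symmetry. apply wcat_nil.
Qed.

Lemma ins_Phi (s : S) (r : nat) (j : bool) (a : brick) (x : X) :
  ins s (length (a s) + r) j (Phi a x) = Phi a (ins s r j x).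
Proof.
  extensionality t. unfold ins, Phi. destruct (eqS t s) as [->|H]; [apply cins_wcat|reflexivity].
Qed.

Lemma tau_ins (g ginv : S -> S) (s : S) (r : nat) (j : bool) (x : X) :
  (forall t, ginv (g t) = t) -> (forall t, g (ginv t) = t) ->
  tau ginv (ins s r j x) = ins (g s) r j (tau ginv x).
Proof.
  intros L R. extensionality t. unfold tau, ins.
  destruct (eqS (ginv t) s) as [E|E], (eqS t (g s)) as [F|F]; try reflexivity; exfalso.
  - apply F. rewrite <- E. symmetry. apply R.
  - apply E. rewrite F. apply L.
Qed.

Lemma sub_disj (s : S) : disj (single s [false; true]) (single s [true; false]).
Proof.
  intros x [u ->] K. change [false; true] with ([false] ++ [true]) in K.
  rewrite <- Phi_single_app in K. destruct K as [v K].
  change [true; false] with ([true] ++ [false]) in K. rewrite <- Phi_single_app in K.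
  symmetry in K. exact (Phi_single_disj _ _ _ K).
Qed.

(** Swapping the words 01 and 10 exchanges the first two letters; the recursion continues below the
    new first letter until the old one has reached position [r]. Being made of copies of swaps, the
    map lies in [N] on every brick. *)
Fixpoint rho (s : S) (r : nat) : El G :=
  match r with
  | 0 => one
  | Datatypes.S r => copy (single s [false]) (rho s r) ** copy (single s [true]) (rho s r) **
      sw (single s [false; true]) (single s [true; false])
  end.

Lemma sub_sw (s : S) (i j : bool) (u : X) :
  sw (G := G) (single s [false; true]) (single s [true; false]) (Phi (single s [i; j]) u) =
  Phi (single s [j; i]) u.
Proof.
  assert (O : forall i j k, ~ inb (single s [j; k]) (Phi (single s [i; i]) u) \/ j = k).
  { intros i' j' k. destruct (Bool.bool_dec j' k) as [|Hjk]; [auto|left].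
    change [i'; i'] with ([i'] ++ [i']). rewrite <- Phi_single_app.
    intros [v K]. change [j'; k] with ([j'] ++ [k]) in K. rewrite <- Phi_single_app in K.
    assert (E1 := f_equal (fun f => f s 0) K). assert (E2 := f_equal (fun f => f s 1) K).
    cbn beta in E1, E2. rewrite !Phi_single_bits, !ifT in E1, E2 by reflexivity.
    rewrite !bit_Phi_single, ifT in E2 by reflexivity. congruence. }
  destruct i, j.
  - apply sw_o; fs; [apply sub_disj| |]; edestruct (O true) as [K|K]; try exact K; discriminate.
  - apply sw_r; fs. apply sub_disj.
  - apply sw_l; fs. apply sub_disj.
  - apply sw_o; fs; [apply sub_disj| |]; edestruct (O false) as [K|K]; try exact K; discriminate.
Qed.

Lemma rho_fw (s : S) (r : nat) (j : bool) (u : X) :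
  rho s r (Phi (single s [j]) u) = ins s r j u.
Proof.
  revert u. induction r as [|r IH]; intro u; [symmetry; apply ins_0|].
  destruct (split_bit s u) as (k & v & ->). cbn [rho].
  rewrite mul_fw, (Phi_single_app s [j] [k]). cbn [app]. rewrite sub_sw.
  change [k; j] with ([k] ++ [j]). rewrite <- Phi_single_app, copy_halves, IH.
  rewrite <- ins_Phi. f_equal. rewrite single_same. reflexivity.
Qed.

Lemma Nloc_rho (s : S) (r : nat) : Nloc (rho s r).
Proof.
  induction r as [|r IH]; [apply Nloc_one|]. cbn [rho].
  apply Nloc_mul; [apply Nloc_mul; apply Nloc_copy; fs|]. apply Nloc_sw; fs; [apply sub_disj|].
  exists (Phi (single s [false; false]) (fun _ _ => false)).
  change [false; false] with ([false] ++ [false]). rewrite <- Phi_single_app. split.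
  - intros [v K]. change [false; true] with ([false] ++ [true]) in K.
    rewrite <- Phi_single_app in K. apply Phi_inj in K. symmetry in K.
    exact (Phi_single_disj _ _ _ K).
  - intros [v K]. change [true; false] with ([true] ++ [false]) in K.
    rewrite <- Phi_single_app in K. symmetry in K. exact (Phi_single_disj _ _ _ K).
Qed.

(** The product is built factor by factor: after [m] factors it agrees with [q] on the first [m]
    bricks and is the identity outside them. *)
Lemma product_of_copies (P : El G -> Prop) (n : nat) (psi : nat -> brick) (T : nat -> El G)
  (q : El G) : P one -> (forall f g, P f -> P g -> P (f ** g)) ->
  brick_partition n psi -> (forall i, i < n -> P (copy (psi i) (T i))) ->
  (forall i u, i < n -> q (Phi (psi i) u) = Phi (psi i) (T i u)) -> P q.
Proof.
  intros P1 PM (F & C & D) HT Hq.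
  assert (K : forall m, m <= n -> exists g, P g /\
    (forall i u, i < m -> g (Phi (psi i) u) = q (Phi (psi i) u)) /\
    (forall x, (forall i, i < m -> ~ inb (psi i) x) -> g x = x)).
  { induction m as [|m IH]; intro Hm.
    - exists one. split; [exact P1|]. split; [lia|reflexivity].
    - destruct IH as (g & Pg & G1 & G2); [lia|].
      assert (Fm : fin_supp (psi m)) by (apply F; lia).
      exists (g ** copy (psi m) (T m)). split; [apply PM; [exact Pg|apply HT; lia]|].
      assert (Dj : forall i u, i < m -> ~ inb (psi i) (Phi (psi m) u)).
      { intros i u Hi Q. assert (i = m); [|lia].
        apply (D i m (Phi (psi m) u)); try lia; apply in_brick_inb; [exact Q|apply inb_Phi]. }
      split.
      + intros i u Hi. rewrite mul_fw. destruct (Nat.eq_dec i m) as [->|Ne].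
        * rewrite copy_in, Hq by (try lia; exact Fm). apply G2. intros i Hi'. apply Dj, Hi'.
        * rewrite copy_out; [apply G1; lia|exact Fm|]. intros [v Q].
          apply (Dj i v); [lia|]. rewrite <- Q. apply inb_Phi.
      + intros x Hx. rewrite mul_fw, copy_out; [|exact Fm|apply Hx; lia].
        apply G2. intros i Hi. apply Hx. lia. }
  destruct (K n (Nat.le_refl n)) as (g & Pg & G1 & _).
  replace q with g; [exact Pg|]. apply El_ext. intro x.
  destruct (C x) as (i & Hi & Hx). apply in_brick_inb in Hx. destruct Hx as [u ->].
  apply G1, Hi.
Qed.

(* [k] differs from its doubling, two copies of [k] on the halves of the
   configuration space, only by the way in which the extra letter is inserted. *)
Lemma doubling (k : El G) : exists (q : El G) (d : nat), Nloc q /\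
  k = q ** rho s0 d ** (copy (half0 s0) k ** copy (half1 s0) k) ** inv (rho s0 d).
Proof.
  destruct (lpw_SV G HG k (inv k) (inv_fw k) (fw_inv k) (fw_lpw k))
    as (_ & n & phi & psi & ga & gi & _ & Ppsi & Hk).
  (* No word at [s0] is longer than [d], so a letter inserted at depth [d] falls into the tail
     behind every brick. *)
  assert (Hd : exists d, forall i, i < n ->
    length (phi i s0) <= d /\ length (psi i s0) <= d).
  { clear. induction n as [|n [d IH]]; [exists 0; lia|].
    exists (d + length (phi n s0) + length (psi n s0)). intros i Hi.
    destruct (Nat.eq_dec i n) as [->|Ne]; [lia|]. specialize (IH i). lia. }
  destruct Hd as [d Hd].
  set (D := copy (half0 s0) k ** copy (half1 s0) k).
  exists (k ** rho s0 d ** inv D ** inv (rho s0 d)), d. split; [|grp].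
  (* Behind [psi i], the conjugated doubling leaves the inserted letter at position
     [d - length (psi i s0)] of [s0]. Applying [k] after the insertion instead carries the letter
     from position [d - length (phi i s0)] of [s0] to the same position of [ga i s0]. [T i] moves it
     from the former place to the latter. *)
  set (T := fun i => rho (ga i s0) (d - length (phi i s0)) ** beta s0 (ga i s0) **
    inv (rho s0 (d - length (psi i s0)))).
  apply (product_of_copies Nloc n psi T); [apply Nloc_one|apply Nloc_mul|exact Ppsi| |].
  - intros i Hi. apply Nloc_copy; [apply Ppsi, Hi|].
    apply Nloc_mul; [apply Nloc_mul; [apply Nloc_rho|apply Nloc_beta]|].
    apply Nloc_inv, Nloc_rho.
  - intros i z Hi. destruct (Hk i Hi) as (_ & L & R & E). destruct (Hd i Hi) as [d1 d2].
    set (r := d - length (phi i s0)). set (r' := d - length (psi i s0)).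
    assert (Er : d = length (phi i s0) + r) by lia.
    assert (Er' : d = length (psi i s0) + r') by lia.
    rewrite <- (fw_inv (rho s0 r') z).
    destruct (split_bit s0 (inv (rho s0 r') z)) as (j & v & ->).
    unfold T. fold r r'. rewrite !mul_fw, inv_fw, beta_eq, !rho_fw.
    rewrite <- (ins_Phi s0 r' j (psi i) v), <- Er', <- (rho_fw s0 d), inv_fw.
    assert (ED : D (Phi (single s0 [j]) (Phi (phi i) (tau (ga i) v))) =
      Phi (single s0 [j]) (Phi (psi i) v)).
    { unfold D. unfold half0, half1. rewrite copy_halves, E. f_equal. f_equal.
      extensionality t. unfold tau. rewrite R. reflexivity. }
    rewrite <- ED, inv_fw, rho_fw, Er, ins_Phi, E. f_equal.
    rewrite (tau_ins (ga i) (gi i)) by assumption. f_equal.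
    extensionality t. unfold tau. rewrite R. reflexivity.
Qed.

Lemma copy_proper_in_N (k : El G) (a : brick) : fin_supp a -> proper a -> N (copy a k).
Proof.
  intros Ha Pa. destruct (doubling k) as (q & d & Hq & E).
  apply (copy_square k (copy a q ** copy a (rho s0 d)) (copy a (inv (rho s0 d))) a
    (bcat a (half0 s0)) (bcat a (half1 s0))); unfold half0, half1; fs; try apply proper_single.
  - apply (NM NN); [apply Hq, Ha|apply Nloc_rho, Ha].
  - apply Nloc_inv; [apply Nloc_rho|exact Ha].
  - rewrite E at 1. unfold half0, half1. rewrite <- !copy_mul, !copy_copy by fs. grp.
Qed.

(** [ls h U] undoes [h] on [U], so [ls h U ** h] fixes a brick pointwise and is conjugate to a copy
    on a proper brick. *)
Lemma all_in_N (h : El G) : N h.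
Proof.
  destruct (classic (exists x, h x <> x)) as [[x Hx]|K].
  2:{ replace h with (one (G := G)); [apply (N1 NN)|]. apply El_ext. intro x. simpl.
      apply NNPP. intro Q. apply K. exists x. intro E. apply Q. symmetry. exact E. }
  destruct (moved_brick h x Hx) as (b & Hb & _ & Mb).
  assert (Hb0 : fin_supp (bcat b (half0 s0))) by (unfold half0; fs).
  (* Only half of [b] is used: a point of the other half lies neither in [U] nor in its image, as
     [Nls] requires. *)
  set (U := inb (bcat b (half0 s0))).
  assert (Ub : forall y, U y -> inb b y) by (intro; apply inb_bcat_l).
  assert (M : movable h U).
  { split; [apply (clopen_brick G HG), Hb0|]. intros y Hy K.
    apply (Mb y); [apply Ub, Hy|apply Ub, K]. }
  assert (Nl : N (ls h U)).
  { apply (Nls h U (Phi b (Phi (half1 s0) x))); [exact M| |].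
    - unfold U. rewrite inb_bcat. intro K. apply (halves_disj s0 _ K), inb_Phi.
    - intro K. apply Ub in K. apply (Mb _ K). rewrite fw_inv. apply inb_Phi. }
  apply (NMl NN (ls h U)); [exact Nl|].
  destruct (flexible (G := G) s0 (fun y => ~ U y) (half0 s0) (bcat b (half0 s0))) as [g Hg].
  { apply fin_half0. }
  { exact Hb0. }
  { unfold U. tauto. }
  apply (NJ_iff NN g).
  destruct (supp_copy (half0 s0) (g ** (ls h U ** h) ** inv g)) as [k ->].
  - apply fin_half0.
  - apply (supp_mono _ (fun y => ~ U (inv g y))).
    + intros y Hy. rewrite <- (fw_inv g y). apply Hg, Hy.
    + apply (supp_conj (ls h U ** h) g (fun y => ~ U y)). intros y Hy. apply NNPP in Hy.
      rewrite mul_fw, ls_r; rewrite ?inv_fw; auto.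
  - apply copy_proper_in_N; [apply fin_half0|apply proper_half0].
Qed.

End Swaps.

Section Simple.
Context {S : Type}.
Context {G : (S -> S) -> Prop} {HG : perm_group G}.

Lemma El_simple (s0 : S) (N : El G -> Prop) (n : El G) :
  Normal N -> N n -> n <> one -> forall h, N h.
Proof.
  intros NN Nn Hn. assert (E : exists x, n x <> x).
  { apply NNPP. intro K. apply Hn, El_ext. intro x. apply NNPP. intro Q. apply K.
    exists x. exact Q. }
  destruct E as [x Hx].
  apply (all_in_N s0 N NN). intros h U. apply (ls_in_N s0 N NN n Nn x Hx).
Qed.

End Simple.

(** * Generation *)

Section Generation.
Context {S : Type}.
Notation brick := (S -> list bool).
Notation X := (Config S).
Context {G : (S -> S) -> Prop} {HG : perm_group G}.
Variable s0 : S.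

Definition gen (A : El G -> Prop) (h : El G) : Prop :=
  forall K : El G -> Prop, Sub K -> (forall f, A f -> K f) -> K h.

Lemma gen_Sub (A : El G -> Prop) : Sub (gen A).
Proof.
  split; [|split].
  - intros K HK _. apply HK.
  - intros f g Hf Hg K HK HA. apply HK; [apply Hf|apply Hg]; assumption.
  - intros f Hf K HK HA. apply HK, Hf; assumption.
Qed.

Lemma gen_conj (A B : El G -> Prop) (g h : El G) :
  (forall f, A f -> B (g ** f ** inv g)) -> gen A h -> gen B (g ** h ** inv g).
Proof.
  intros H Hh. apply (Hh (fun h => gen B (g ** h ** inv g))).
  - destruct (gen_Sub B) as (B1 & BM & BV). split; [|split].
    + replace (g ** one ** inv g) with (one (G := G)) by grp. exact B1.
    + intros f k Hf Hk.
      replace (g ** (f ** k) ** inv g) with ((g ** f ** inv g) ** (g ** k ** inv g)) by grp.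
      apply BM; assumption.
    + intros f Hf. replace (g ** inv f ** inv g) with (inv (g ** f ** inv g)) by grp.
      apply BV, Hf.
  - intros f Hf K _ HB. apply HB, H, Hf.
Qed.

Lemma gen_mono (A B : El G -> Prop) (h : El G) :
  (forall f, A f -> B f) -> gen A h -> gen B h.
Proof. intros H Hh K HK HB. apply Hh; auto. Qed.

Lemma sw_half_neq_one : sw (half0 s0) (half1 s0) <> one (G := G).
Proof.
  intro K. assert (E := sw_l (G := G) (half0 s0) (half1 s0) (fun _ _ => false)
    (fin_half0 s0) (fin_half1 s0) (halves_disj s0)).
  rewrite K in E. symmetry in E. exact (Phi_single_disj _ _ _ E).
Qed.

(** Local swaps are closed under conjugation, so the subgroup they generate is normal and simplicity
    applies to it. *)
Lemma swaps_generate (K : El G -> Prop) : Sub K ->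
  (forall h U, movable h U -> K (ls h U)) -> forall h, K h.
Proof.
  intros HK Hls h.
  set (A := fun f : El G => exists h U, movable h U /\ f = ls h U).
  assert (Hh : gen A h); [|apply (Hh K HK); intros f (k & U & M & ->); apply Hls, M].
  apply (El_simple s0 (gen A) (sw (half0 s0) (half1 s0))); [| |apply sw_half_neq_one].
  - split; [apply gen_Sub|]. intros g n. apply gen_conj. intros f (k & U & M & ->).
    exists (g ** k ** inv g), (fun x => U (inv g x)).
    split; [apply movable_conj, M|apply conj_ls, M].
  - intros L _ HL. apply HL.
    destruct (sw_ls (G := G) (half0 s0) (half1 s0) (fin_half0 s0) (fin_half1 s0) (halves_disj s0)) as [M E].
    eexists _, _. split; [exact M|exact E].
Qed.

Definition comms (l : list (El G)) (h : El G) : Prop :=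
  exists f g, In f l /\ In g l /\ h = comm f g.

Definition involutions (l : list (El G)) : Prop := forall f, In f l -> f ** f = one.

(** The elements reached from some finite list of involutions form a normal subgroup: lists are
    concatenated for products and conjugated for conjugates. It contains the swap of the two halves,
    which [ls_comm] writes as a commutator of two involutions. *)
Lemma commutators_generate (h : El G) : exists l, involutions l /\ gen (comms l) h.
Proof.
  destruct (sw_ls (G := G) (half0 s0) (half1 s0) (fin_half0 s0) (fin_half1 s0) (halves_disj s0)) as [M E].
  destruct (ls_comm s0 _ _ M) as (t & k & Etk & tt & kk & _).
  revert h. apply (El_simple s0 (fun h => exists l, involutions l /\ gen (comms l) h)
    (sw (half0 s0) (half1 s0))); [split; [split; [|split]|]| |apply sw_half_neq_one].
  - exists []. split; [intros f []|apply gen_Sub].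
  - intros f g (l & Hl & Hf) (m & Hm & Hg). exists (l ++ m). split.
    + intros i Hi. apply in_app_or in Hi. destruct Hi; auto.
    + apply gen_Sub; [revert Hf|revert Hg]; apply gen_mono;
        intros i (u & v & Hu & Hv & ->); exists u, v;
        repeat split; apply in_or_app; auto.
  - intros f (l & Hl & Hf). exists l. split; [exact Hl|]. apply gen_Sub, Hf.
  - intros g f (l & Hl & Hf). exists (map (fun i => g ** i ** inv g) l). split.
    + intros i Hi. apply in_map_iff in Hi. destruct Hi as (j & <- & Hj).
      transitivity (g ** (j ** j) ** inv g); [grp|]. rewrite (Hl j Hj). grp.
    + revert Hf. apply gen_conj. intros i (u & v & Hu & Hv & ->).
      exists (g ** u ** inv g), (g ** v ** inv g).
      split; [|split]; [apply in_map_iff; eauto|apply in_map_iff; eauto|].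
      unfold comm. grp.
  - exists [t; k]. split; [intros f [<-|[<-|[]]]; assumption|].
    intros L _ HL. apply HL. exists t, k. simpl. rewrite <- Etk. auto.
Qed.

Lemma finitely_many_commutators (l0 : list (El G)) : (forall h, gen (fun f => In f l0) h) ->
  exists l, involutions l /\ forall h, gen (comms l) h.
Proof.
  intro Hl0.
  assert (H : exists l, involutions l /\ forall f, In f l0 -> gen (comms l) f).
  { clear Hl0. induction l0 as [|f l0 (l & Hl & IH)].
    - exists []. split; intros f [].
    - destruct (commutators_generate f) as (m & Hm & Hf). exists (m ++ l). split.
      + intros i Hi. apply in_app_or in Hi. destruct Hi; auto.
      + intros i [<-|Hi]; [revert Hf|specialize (IH i Hi); revert IH]; apply gen_mono;
          intros j (u & v & Hu & Hv & ->); exists u, v; repeat split; apply in_or_app; auto. }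
  destruct H as (l & Hl & H). exists l. split; [exact Hl|].
  intro h. apply (Hl0 h); [apply gen_Sub|exact H].
Qed.

Lemma ls_split (h : El G) (U A : X -> Prop) : movable h U -> clopen G A ->
  movable h (fun x => U x /\ A x) /\ movable h (fun x => U x /\ ~ A x) /\
  ls h U = ls h (fun x => U x /\ A x) ** ls h (fun x => U x /\ ~ A x).
Proof.
  intros M CA. pose proof M as [C D].
  assert (M1 : movable h (fun x => U x /\ A x)).
  { apply (movable_sub h U); [exact M|apply (clopen_and G HG); assumption|tauto]. }
  assert (M2 : movable h (fun x => U x /\ ~ A x)).
  { apply (movable_sub h U); [exact M|apply (clopen_and G HG U); [assumption|]|tauto].
    apply (clopen_not G), CA. }
  assert (D' : forall x, U x -> ~ U (inv h x)).
  { intros x Hx K. apply (D _ K). rewrite fw_inv. exact Hx. }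
  split; [exact M1|]. split; [exact M2|]. symmetry. apply ls_eq; [exact M| | |].
  - intros x Hx. rewrite mul_fw. destruct (classic (A x)) as [Ax|Ax].
    + rewrite (ls_o h (fun x => U x /\ ~ A x) x), ls_l; try tauto.
      intros [K _]. apply (D' x); assumption.
    + rewrite (ls_l h (fun x => U x /\ ~ A x) x) by tauto. apply ls_o; [exact M1| |].
      * intros [K _]. apply (D x); assumption.
      * rewrite inv_fw. tauto.
  - intros x Hx. rewrite mul_fw. destruct (classic (A x)) as [Ax|Ax].
    + rewrite (ls_o h (fun x => U x /\ ~ A x) (h x)).
      * rewrite ls_r; rewrite ?inv_fw; auto.
      * exact M2.
      * intros [K _]. apply (D x); assumption.
      * rewrite inv_fw. tauto.
    + rewrite (ls_r h (fun x => U x /\ ~ A x) (h x)); rewrite ?inv_fw; auto.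
      apply ls_o; [exact M1|tauto|]. intros [K _]. apply (D' x); assumption.
  - intros x Hx Hx'. rewrite mul_fw, (ls_o h (fun x => U x /\ ~ A x) x); try tauto.
    apply ls_o; tauto.
Qed.

(** Cutting [U] along the sets of the cover, one after another, writes [ls h U] as a product of
    swaps over pieces that each lie in one of these sets. *)
Lemma ls_pieces (K : El G -> Prop) (h : El G) (L : list (X -> Prop)) :
  Sub K -> (forall A, In A L -> clopen G A) -> forall U, movable h U ->
  (forall x, U x -> exists A, In A L /\ A x) ->
  (forall A V, In A L -> movable h V -> (forall x, V x -> U x /\ A x) -> K (ls h V)) ->
  K (ls h U).
Proof.
  intros HK. induction L as [|A L IH]; intros CL U M Cov Hp.
  - replace (ls h U) with (one (G := G)); [apply HK|].
    apply ls_eq; [exact M| | |]; try reflexivity; intros x Hx; destruct (Cov x Hx) as (A & [] & _).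
  - destruct (ls_split h U A M) as (M1 & M2 & ->); [apply CL; left; reflexivity|].
    apply HK.
    + apply (Hp A); [left; reflexivity|exact M1|auto].
    + apply IH; [intros; apply CL; right; assumption|exact M2| |].
      * intros x [Hx Ax]. destruct (Cov x Hx) as (B & [<-|HB] & Bx); [contradiction|eauto].
      * intros B V HB MV HV. apply (Hp B); [right; exact HB|exact MV|].
        intros x Hx. destruct (HV x Hx) as [[? ?] ?]. auto.
Qed.

(** This is [flexible] inside [a]: the preimage of [U] under [Phi a] misses a brick because [U]
    misses a point of [a]. *)
Lemma flexible_in (a b : brick) (U : X -> Prop) (x : X) : fin_supp a -> fin_supp b ->
  clopen G U -> inb a x -> ~ U x ->
  exists k : El G, forall y, U y -> inb a y -> inb (bcat a b) (copy a k y).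
Proof.
  intros Ha Hb [_ C] [u ->] Hx.
  destruct (opn_nbhd G (fun v => True /\ ~ U (Phi a v)) u) as (c & Hc & _ & Hsub); [|auto|].
  { apply (opn_pre G HG _ (fun x => ~ U x) (Phi a)); [apply lpw_Phi, Ha|exact C]. }
  destruct (flexible (G := G) s0 (fun v => U (Phi a v)) b c Hb Hc) as [k Hk].
  { intros v Hv. apply (Hsub v Hv). }
  exists k. intros y Hy [v ->]. rewrite copy_in by exact Ha. apply inb_bcat, Hk, Hy.
Qed.

Lemma conj_sw (g : El G) (a b a' b' : brick) : fin_supp a -> fin_supp b -> fin_supp a' ->
  fin_supp b' -> disj a b -> disj a' b' -> (forall u, g (Phi a u) = Phi a' u) ->
  (forall u, g (Phi b u) = Phi b' u) -> g ** sw a b ** inv g = sw a' b'.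
Proof.
  intros Ha Hb Ha' Hb' D D' Ea Eb. apply El_ext. intro x. rewrite !mul_fw.
  destruct (classic (inb a' x)) as [[u ->]|Hx].
  - rewrite sw_l, <- Ea, inv_fw, sw_l by assumption. apply Eb.
  - destruct (classic (inb b' x)) as [[u ->]|Hx'].
    + rewrite sw_r, <- Eb, inv_fw, sw_r by assumption. apply Ea.
    + rewrite (sw_o a' b'), sw_o, fw_inv; try assumption; try reflexivity.
      * intros [u K]. apply Hx. exists u. rewrite <- Ea, <- K. symmetry. apply fw_inv.
      * intros [u K]. apply Hx'. exists u. rewrite <- Eb, <- K. symmetry. apply fw_inv.
Qed.

(** Meant for [gen_b] and a translate of it: [f] and [g] are the factors on the brick that they
    share, [u] and [v] the remaining ones, and only the shared brick leaves a trace in the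
    commutator. *)
Lemma comm_split (f u g v : El G) : u ** g = g ** u -> u ** v = v ** u -> f ** v = v ** f ->
  comm (f ** u) (g ** v) = comm f g.
Proof.
  intros E1 E2 E3. unfold comm.
  transitivity (f ** (u ** g) ** v ** inv u ** inv f ** inv v ** inv g); [grp|].
  rewrite E1. transitivity (f ** g ** (u ** v) ** inv u ** inv f ** inv v ** inv g); [grp|].
  rewrite E2. transitivity (f ** g ** (v ** inv f) ** inv v ** inv g); [grp|].
  replace (v ** inv f) with (inv f ** v); [grp|].
  transitivity (inv f ** (v ** f) ** inv f); [grp|]. rewrite <- E3. grp.
Qed.

Fixpoint pow (f : El G) (n : nat) : El G :=
  match n with 0 => one | Datatypes.S n => f ** pow f n end.

Lemma pow_iter (f : El G) (n : nat) (x : X) : pow f n x = Nat.iter n f x.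
Proof. induction n as [|n IH]; [reflexivity|]. simpl. rewrite IH. reflexivity. Qed.

Lemma glue_partitions (n : nat) (phi psi : nat -> brick) :
  brick_partition n phi -> brick_partition n psi ->
  exists g : El G, forall i u, i < n -> g (Phi (phi i) u) = Phi (psi i) u.
Proof.
  assert (F : forall phi psi : nat -> brick, brick_partition n phi -> exists g : X -> X,
    forall i u, i < n -> g (Phi (phi i) u) = Phi (psi i) u).
  { clear phi psi. intros phi psi (_ & C & D).
    set (idx := fun x => proj1_sig (constructive_indefinite_description _ (C x))).
    assert (Hidx : forall x, idx x < n /\ in_brick (phi (idx x)) x).
    { intro x. exact (proj2_sig (constructive_indefinite_description _ (C x))). }
    exists (fun x => Phi (psi (idx x)) (unPhi (phi (idx x)) x)). intros i u Hi.
    assert (E : idx (Phi (phi i) u) = i).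
    { apply (D _ _ (Phi (phi i) u)); try apply Hidx; [exact Hi|]. apply in_brick_inb, inb_Phi. }
    rewrite E, unPhi_Phi. reflexivity. }
  intros P Q. destruct (F phi psi P) as [g Hg]. destruct (F psi phi Q) as [k Hk].
  destruct P as (FP & CP & _), Q as (FQ & CQ & _).
  exists (mk g k). intros i u Hi. rewrite mk_fw; [apply Hg, Hi| | |].
  - intro x. destruct (CP x) as (j & Hj & Hx). apply in_brick_inb in Hx. destruct Hx as [v ->].
    rewrite Hg, Hk by exact Hj. reflexivity.
  - intro x. destruct (CQ x) as (j & Hj & Hx). apply in_brick_inb in Hx. destruct Hx as [v ->].
    rewrite Hk, Hg by exact Hj. reflexivity.
  - exists (map (fun i => Chart (phi i) (psi i) (fun s => s) (fun s => s)) (seq 0 n)).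
    intros x _. destruct (CP x) as (j & Hj & Hx). eexists. split; [|split; [|split]].
    + apply in_map_iff. exists j. split; [reflexivity|]. apply in_seq. lia.
    + repeat split; simpl; auto. apply HG.
    + apply in_brick_inb, Hx.
    + intro v. split; [exact I|]. apply Hg, Hj.
Qed.

End Generation.

Arguments gen {S G HG} A h.
Arguments comms {S G HG} l h.

(** * Two torsion generators *)

(* The numbers [2 ^ e - 1] form a Sidon set. *)
Lemma pow2_sidon (a b c d : nat) :
  2 ^ a + 2 ^ b = 2 ^ c + 2 ^ d -> (a = c /\ b = d) \/ (a = d /\ b = c).
Proof.
  assert (posi : forall n, 1 <= 2 ^ n) by (intro n; pose proof (Nat.pow_nonzero 2 n); lia).
  assert (W : forall a b c d, b <= a -> d <= c -> 2 ^ a + 2 ^ b = 2 ^ c + 2 ^ d -> a = c /\ b = d).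
  { assert (Lt : forall a b c d, b <= a -> d <= c -> a < c -> 2 ^ a + 2 ^ b < 2 ^ c + 2 ^ d).
    { clear -posi. intros a b c d Hb Hd Hac.
      assert (2 ^ b <= 2 ^ a) by (apply Nat.pow_le_mono_r; lia).
      assert (2 ^ (1 + a) <= 2 ^ c) by (apply Nat.pow_le_mono_r; lia).
      specialize (posi d). rewrite Nat.pow_add_r in *. simpl in *. lia. }
    clear -Lt. intros a b c d Hb Hd E.
    assert (a = c).
    { destruct (Nat.lt_trichotomy a c) as [H|[H|H]]; [|exact H|].
      - specialize (Lt a b c d Hb Hd H). lia.
      - specialize (Lt c d a b Hd Hb H). lia. }
    subst c. split; [reflexivity|]. apply (Nat.pow_inj_r 2); lia. }
  intro E. destruct (Nat.le_ge_cases b a), (Nat.le_ge_cases d c).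
  - left. apply W; assumption.
  - right. destruct (W a b d c); auto; lia.
  - right. destruct (W b a c d); auto; lia.
  - left. destruct (W b a d c); auto; lia.
Qed.

Section TwoGenerators.
Context {S : Type}.
Notation brick := (S -> list bool).
Notation X := (Config S).
Context {G : (S -> S) -> Prop} {HG : perm_group G}.
Variable s0 : S.
Variable l : list (El G).
Hypothesis Hl : involutions l.
Hypothesis Hgen : forall h, gen (comms l) h.

Let m := length l.
(** The exponents below [m + 2] provide places for the two ends of [link 0] and for the [m]
    involutions. Two places add up to less than [n], so congruences modulo [n] between such sums are
    equalities. *)
Let n := 2 ^ (m + 2).
Let f (i : nat) : El G := nth i l one.

Variable E0 : nat -> brick.
Hypothesis HE0 : brick_partition n E0.

Let E (k : nat) : brick := E0 (k mod n).

Lemma n_pos : 4 <= n.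
Proof.
  unfold n. rewrite Nat.pow_add_r. pose proof (Nat.pow_nonzero 2 m). simpl. lia.
Qed.

Lemma mod_lt (k : nat) : k mod n < n.
Proof. apply Nat.mod_upper_bound. pose proof n_pos. lia. Qed.

Lemma fin_E (k : nat) : fin_supp (E k).
Proof. apply HE0, mod_lt. Qed.

Lemma E_cover (x : X) : exists k, k < n /\ inb (E k) x.
Proof.
  destruct HE0 as (_ & C & _). destruct (C x) as (k & Hk & Hx). exists k. split; [exact Hk|].
  unfold E. rewrite Nat.mod_small by exact Hk. apply in_brick_inb, Hx.
Qed.

Lemma E_disj (i j : nat) (x : X) : inb (E i) x -> inb (E j) x -> i mod n = j mod n.
Proof.
  intros Hi Hj. destruct HE0 as (_ & _ & D).
  apply (D _ _ x); try apply mod_lt; apply in_brick_inb; assumption.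
Qed.

Lemma E_mod (i j : nat) : i mod n = j mod n -> E i = E j.
Proof. intro H. unfold E. rewrite H. reflexivity. Qed.

Lemma add_mod_cancel (i j k : nat) : (i + k) mod n = (j + k) mod n -> i mod n = j mod n.
Proof.
  intro H. pose proof n_pos.
  assert (K : forall i, i mod n = ((i + k) mod n + (n - k mod n)) mod n).
  { intro t. rewrite Nat.Div0.add_mod_idemp_l.
    replace (t + k + (n - k mod n)) with (t + (k / n + 1) * n).
    - rewrite Nat.Div0.mod_add. reflexivity.
    - pose proof (Nat.div_mod_eq k n). pose proof (mod_lt k). nia. }
  rewrite (K i), (K j), H. reflexivity.
Qed.

Lemma rotation_exists : exists a : El G, forall k u, a (Phi (E k) u) = Phi (E (k + 1)) u.
Proof.
  destruct (glue_partitions (G := G) n E0 (fun i => E (i + 1)) HE0) as [a Ha].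
  - split; [|split].
    + intros i _. apply fin_E.
    + intro x. destruct (E_cover x) as (k & Hk & Hx). exists ((k + (n - 1)) mod n).
      split; [apply mod_lt|]. apply in_brick_inb. rewrite (E_mod _ k); [exact Hx|].
      rewrite Nat.Div0.add_mod_idemp_l. pose proof n_pos.
      replace (k + (n - 1) + 1) with (k + 1 * n) by lia. apply Nat.Div0.mod_add.
    + intros i j x Hi Hj Ki Kj. apply in_brick_inb in Ki, Kj.
      pose proof (add_mod_cancel _ _ _ (E_disj _ _ _ Ki Kj)) as H.
      rewrite !Nat.mod_small in H by assumption. exact H.
  - exists a. intros k u. unfold E at 1. rewrite Ha by apply mod_lt. f_equal.
    apply E_mod. apply Nat.Div0.add_mod_idemp_l.
Qed.

Variable a : El G.
Hypothesis Ha : forall k u, a (Phi (E k) u) = Phi (E (k + 1)) u.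

Lemma pow_a (j k : nat) (u : X) : pow a j (Phi (E k) u) = Phi (E (k + j)) u.
Proof.
  induction j as [|j IH]; [rewrite Nat.add_0_r; reflexivity|].
  cbn [pow]. rewrite mul_fw, IH, Ha. f_equal. f_equal. lia.
Qed.

Lemma a_order : pow a n = one.
Proof.
  apply El_ext. intro x. destruct (E_cover x) as (k & _ & [u ->]).
  rewrite pow_a, (E_mod (k + n) k); [reflexivity|].
  replace (k + n) with (k + 1 * n) by lia. apply Nat.Div0.mod_add.
Qed.

(** Subtracting one keeps the Sidon property and sends the exponents 0 and 1 to 0 and 1, the
    adjacent bricks exchanged in part by [link 0]. *)
Definition pos (e : nat) : nat := 2 ^ e - 1.

Lemma pos_sum (e e' : nat) : e < m + 2 -> e' < m + 2 -> pos e + pos e' < n.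
Proof.
  intros H H'. unfold pos, n.
  assert (K : forall e, e < m + 2 -> 2 ^ e <= 2 ^ (m + 1)) by (intros; apply Nat.pow_le_mono_r; lia).
  pose proof (K e H). pose proof (K e' H').
  assert (2 ^ (m + 2) = 2 * 2 ^ (m + 1)) by (rewrite <- Nat.pow_succ_r'; f_equal; lia).
  pose proof (Nat.pow_nonzero 2 e). lia.
Qed.

Lemma pos_sidon (x y u v : nat) : pos x + pos y = pos u + pos v -> (x = u /\ y = v) \/ (x = v /\ y = u).
Proof.
  assert (P : forall e, pos e + 1 = 2 ^ e).
  { intro e. unfold pos. pose proof (Nat.pow_nonzero 2 e). lia. }
  intro H. apply pow2_sidon. rewrite <- !P. lia.
Qed.

Lemma pos_disj (e e' : nat) (x : X) : e < m + 2 -> e' < m + 2 ->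
  inb (E (pos e)) x -> inb (E (pos e')) x -> e = e'.
Proof.
  intros H H' K K'. pose proof (pos_sum e e H H). pose proof (pos_sum e' e' H' H').
  pose proof (E_disj _ _ _ K K') as Q. rewrite !Nat.mod_small in Q by lia.
  destruct (pos_sidon e e e' e'); lia.
Qed.

(** Only first halves are exchanged. In [K_ls_between] the second half of a brick shelters the image
    of [U] while [U] itself is passed along by links. *)
Definition link (k : nat) : El G := sw (bcat (E k) (half0 s0)) (bcat (E (k + 1)) (half0 s0)).

Lemma fin_EH (k : nat) : fin_supp (bcat (E k) (half0 s0)).
Proof. apply fin_supp_bcat; [apply fin_E|apply fin_half0]. Qed.

Lemma mod_neq (i d : nat) : 0 < d -> d < n -> i mod n <> (i + d) mod n.
Proof.
  intros Hd Hd' H. rewrite Nat.add_comm in H.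
  apply (add_mod_cancel 0 d i) in H. rewrite Nat.Div0.mod_0_l, Nat.mod_small in H; lia.
Qed.

Lemma link_disj (k : nat) : disj (bcat (E k) (half0 s0)) (bcat (E (k + 1)) (half0 s0)).
Proof.
  intros x K L. apply inb_bcat_l in K, L. pose proof n_pos.
  apply (mod_neq k 1); [lia|lia|]. exact (E_disj _ _ _ K L).
Qed.

(* The involutions [f i] are copied on the bricks with index [2 ^ (i + 2) - 1],
   while [link 0] occupies the bricks with index [2 ^ 0 - 1] and [2 ^ 1 - 1]. *)
Fixpoint bprod (k : nat) : El G :=
  match k with
  | 0 => link 0
  | Datatypes.S k => copy (E (pos (k + 2))) (f k) ** bprod k
  end.

Definition gen_b : El G := bprod m.

Lemma bprod_spec (k : nat) : k <= m ->
  (forall i u, i < k -> bprod k (Phi (E (pos (i + 2))) u) = Phi (E (pos (i + 2))) (f i u)) /\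
  (forall x, inb (E (pos 0)) x \/ inb (E (pos 1)) x -> bprod k x = link 0 x) /\
  (forall x, (forall e, e < k + 2 -> ~ inb (E (pos e)) x) -> bprod k x = x).
Proof.
  induction k as [|k IH]; intro Hk.
  - split; [lia|]. split; [reflexivity|]. intros x Hx. apply sw_o; try apply fin_EH.
    + apply link_disj.
    + intro K. apply inb_bcat_l in K. apply (Hx 0); [lia|exact K].
    + intro K. apply inb_bcat_l in K. apply (Hx 1); [lia|exact K].
  - destruct IH as (B1 & B2 & B3); [lia|]. cbn [bprod].
    split; [|split].
    + intros i u Hi. rewrite mul_fw. destruct (Nat.eq_dec i k) as [->|Ne].
      * rewrite B3; [apply copy_in, fin_E|]. intros e He K.
        assert (k + 2 = e); [|lia].
        apply (pos_disj _ _ (Phi (E (pos (k + 2))) u)); try lia; [apply inb_Phi|exact K].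
      * rewrite B1 by lia. apply copy_out; [apply fin_E|]. intro K.
        assert (i + 2 = k + 2); [|lia].
        apply (pos_disj _ _ (Phi (E (pos (i + 2))) (f i u))); try lia; [apply inb_Phi|exact K].
    + intros x Hx. rewrite mul_fw, B2 by exact Hx. apply copy_out; [apply fin_E|]. intro K.
      assert (Hl0 : inb (E (pos 0)) (link 0 x) \/ inb (E (pos 1)) (link 0 x)).
      { apply (supp_stable (link 0) (fun x => inb (E (pos 0)) x \/ inb (E (pos 1)) x)); [|exact Hx].
        intros y Hy. apply sw_o; try apply fin_EH; [apply link_disj| |]; intro Q;
          apply inb_bcat_l in Q; apply Hy; [left|right]; exact Q. }
      destruct Hl0 as [Q|Q].
      * assert (0 = k + 2); [|lia]. apply (pos_disj _ _ (link 0 x)); try lia; assumption.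
      * assert (1 = k + 2); [|lia]. apply (pos_disj _ _ (link 0 x)); try lia; assumption.
    + intros x Hx. rewrite mul_fw, B3.
      * apply copy_out; [apply fin_E|]. apply Hx. lia.
      * intros e He. apply Hx. lia.
Qed.

Lemma f_invol (i : nat) (u : X) : f i (f i u) = u.
Proof.
  rewrite <- mul_fw. replace (f i ** f i) with (one (G := G)); [reflexivity|]. symmetry.
  destruct (Nat.lt_ge_cases i m) as [Hi|Hi].
  - apply Hl, nth_In, Hi.
  - unfold f. rewrite nth_overflow by exact Hi. apply mul1.
Qed.

Lemma b_cases (x : X) :
  (exists i u, i < m /\ x = Phi (E (pos (i + 2))) u) \/
  (inb (E (pos 0)) x \/ inb (E (pos 1)) x) \/ (forall e, e < m + 2 -> ~ inb (E (pos e)) x).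
Proof.
  destruct (classic (exists e, e < m + 2 /\ inb (E (pos e)) x)) as [(e & He & [u Hu])|K].
  - destruct e as [|[|e]].
    + right. left. left. exists u. exact Hu.
    + right. left. right. exists u. exact Hu.
    + left. exists e, u. rewrite Nat.add_comm. split; [lia|exact Hu].
  - right. right. intros e He Q. apply K. eauto.
Qed.

Lemma b_order : gen_b ** gen_b = one.
Proof.
  destruct (bprod_spec m (Nat.le_refl m)) as (B1 & B2 & B3).
  apply El_ext. intro x. unfold gen_b. rewrite mul_fw.
  destruct (b_cases x) as [(i & u & Hi & ->)|[Hx|Hx]].
  - rewrite !B1, f_invol by exact Hi. reflexivity.
  - rewrite (B2 x Hx), B2.
    + rewrite <- mul_fw. unfold link. rewrite sw_invol; [reflexivity|apply fin_EH|apply fin_EH|].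
      apply link_disj.
    + apply (supp_stable (link 0) (fun x => inb (E (pos 0)) x \/ inb (E (pos 1)) x)); [|exact Hx].
      intros y Hy. apply sw_o; try apply fin_EH; [apply link_disj| |]; intro Q;
        apply inb_bcat_l in Q; apply Hy; [left|right]; exact Q.
  - rewrite (B3 x Hx), (B3 x Hx). reflexivity.
Qed.

(* [gen_b] with its factor on the brick of index [pos (i + 2)] removed. *)
Lemma b_remainder (i : nat) : i < m ->
  supp (inv (copy (E (pos (i + 2))) (f i)) ** gen_b)
    (fun x => exists e, e < m + 2 /\ e <> i + 2 /\ inb (E (pos e)) x).
Proof.
  intros Hi x Hx. destruct (bprod_spec m (Nat.le_refl m)) as (B1 & _ & B3).
  rewrite copy_inv, mul_fw by apply fin_E.
  destruct (classic (inb (E (pos (i + 2))) x)) as [[u ->]|K].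
  - unfold gen_b. rewrite B1, copy_in, inv_fw by (exact Hi || apply fin_E). reflexivity.
  - unfold gen_b. rewrite B3; [apply copy_out; [apply fin_E|exact K]|].
    intros e He Q. apply Hx. exists e. split; [exact He|]. split; [|exact Q].
    intros ->. apply K, Q.
Qed.

(** * Subgroups containing the rotation and the involution *)

Variable K : El G -> Prop.
Hypothesis HK : Sub K.
Hypothesis Ka : K a.
Hypothesis Kb : K gen_b.

Lemma K_pow (j : nat) : K (pow a j).
Proof. induction j as [|j IH]; [apply HK|]. apply HK; assumption. Qed.

Lemma K_conj (g h : El G) : K g -> K h -> K (g ** h ** inv g).
Proof.
  intros Hg Hh. destruct HK as (_ & KM & KV). apply KM; [apply KM; assumption|apply KV, Hg].
Qed.

Lemma K_conj_iff (g h : El G) : K g -> K (g ** h ** inv g) -> K h.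
Proof.
  intros Hg Hh. replace h with (inv g ** (g ** h ** inv g) ** inv (inv g)) by grp.
  apply K_conj; [apply HK, Hg|exact Hh].
Qed.

(** A power of [a] carries the copy of [f j] onto the brick of [f i]. Any further overlap of [gen_b]
    with this translate, the link included, would be a coincidence of two sums of places, which the
    Sidon property and [i <> j] exclude. So the commutator of the two lives on that one brick. *)
Lemma K_comm_copy (i j : nat) : i < m -> j < m -> i <> j ->
  K (copy (E (pos (i + 2))) (comm (f i) (f j))).
Proof.
  intros Hi Hj Hij.
  pose proof (pos_sum (i + 2) (i + 2) ltac:(lia) ltac:(lia)) as Pi.
  pose proof (pos_sum (j + 2) (j + 2) ltac:(lia) ltac:(lia)) as Pj.
  (* The shift from the place of [f j] to that of [f i]; adding [n] keeps the subtraction from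
     truncating. *)
  set (d := pos (i + 2) + n - pos (j + 2)). set (c := pow a d).
  set (F := copy (E (pos (i + 2))) (f i)). set (F' := copy (E (pos (j + 2))) (f j)).
  set (u := inv F ** gen_b). set (u' := inv F' ** gen_b). set (v := c ** u' ** inv c).
  set (H := copy (E (pos (i + 2))) (f j)).
  assert (EH : c ** F' ** inv c = H).
  { apply conj_copy; try apply fin_E. intro x. unfold c. rewrite pow_a. f_equal. apply E_mod.
    replace (pos (j + 2) + d) with (pos (i + 2) + 1 * n) by lia. apply Nat.Div0.mod_add. }
  assert (Su : supp u (fun x => exists e, e < m + 2 /\ e <> i + 2 /\ inb (E (pos e)) x))
    by exact (b_remainder i Hi).
  assert (Sv : supp v (fun x => exists e, e < m + 2 /\ e <> j + 2 /\ inb (E (pos e + d)) x)).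
  { apply (supp_mono _ (fun x => exists e, e < m + 2 /\ e <> j + 2 /\ inb (E (pos e)) (inv c x))).
    - intros x (e & He & Ne & [y Hy]). exists e. split; [exact He|]. split; [exact Ne|].
      rewrite <- (fw_inv c x), Hy. unfold c. rewrite pow_a. apply inb_Phi.
    - apply (supp_conj u' c (fun x => exists e, e < m + 2 /\ e <> j + 2 /\ inb (E (pos e)) x)).
      exact (b_remainder j Hj). }
  assert (SF : supp F (inb (E (pos (i + 2))))) by apply copy_supported, fin_E.
  assert (SH : supp H (inb (E (pos (i + 2))))) by apply copy_supported, fin_E.
  (* The supports of [u] and [v] meet only if [pos e + pos (j + 2) = pos e' + pos (i + 2)]. *)
  assert (Key : forall e e' x, e < m + 2 -> e' < m + 2 -> inb (E (pos e)) x ->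
    inb (E (pos e' + d)) x -> pos e + pos (j + 2) = pos e' + pos (i + 2)).
  { intros e e' x He He' Q Q'. pose proof (E_disj _ _ _ Q Q') as R.
    pose proof (pos_sum e (j + 2) He ltac:(lia)). pose proof (pos_sum e' (i + 2) He' ltac:(lia)).
    assert (R' : (pos e + pos (j + 2)) mod n = (pos e' + pos (i + 2)) mod n).
    { rewrite <- Nat.Div0.add_mod_idemp_l, R, Nat.Div0.add_mod_idemp_l.
      replace (pos e' + d + pos (j + 2)) with (pos e' + pos (i + 2) + 1 * n) by lia.
      apply Nat.Div0.mod_add. }
    rewrite !Nat.mod_small in R' by assumption. exact R'. }
  assert (C1 : u ** H = H ** u).
  { apply (supp_commute _ _ _ _ Su SH). intros x (e & He & Ne & Q) Q'.
    apply Ne, (pos_disj _ _ x); try lia; assumption. }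
  assert (C2 : u ** v = v ** u).
  { apply (supp_commute _ _ _ _ Su Sv). intros x (e & He & Ne & Q) (e' & He' & Ne' & Q').
    destruct (pos_sidon _ _ _ _ (Key e e' x He He' Q Q')) as [[? ?]|[? ?]]; lia. }
  assert (C3 : F ** v = v ** F).
  { apply (supp_commute _ _ _ _ SF Sv). intros x Q (e' & He' & Ne' & Q').
    destruct (pos_sidon _ _ _ _ (Key (i + 2) e' x ltac:(lia) He' Q Q')) as [[? ?]|[? ?]]; lia. }
  assert (KC : K (comm gen_b (c ** gen_b ** inv c))).
  { assert (K (c ** gen_b ** inv c)) by (apply K_conj; [apply K_pow|exact Kb]).
    destruct HK as (_ & KM & KV). unfold comm.
    apply KM; [apply KM; [apply KM; assumption|apply KV, Kb]|apply KV; assumption]. }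
  replace (copy (E (pos (i + 2))) (comm (f i) (f j))) with (comm F H).
  - rewrite <- (comm_split F u H v C1 C2 C3).
    replace (F ** u) with gen_b by (unfold u; grp).
    replace (H ** v) with (c ** gen_b ** inv c); [exact KC|].
    rewrite <- EH. unfold v, u'. grp.
  - unfold comm, F, H. rewrite !copy_inv, !copy_mul by apply fin_E. reflexivity.
Qed.

(** The [h] whose copy on [E k] lies in [K] form a subgroup, so the generating commutators suffice;
    a power of [a] carries them to [E k] from the brick where [K_comm_copy] provides them. *)
Lemma K_copy (k : nat) (h : El G) : K (copy (E k) h).
Proof.
  apply (Hgen h (fun h => K (copy (E k) h))).
  - destruct HK as (K1 & KM & KV). split; [|split].
    + rewrite copy_one by apply fin_E. exact K1.
    + intros g g' Hg Hg'. rewrite <- copy_mul by apply fin_E. apply KM; assumption.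
    + intros g Hg. rewrite <- copy_inv by apply fin_E. apply KV, Hg.
  - intros c (g & g' & Hg & Hg' & ->).
    destruct (In_nth _ _ one Hg) as (i & Hi & <-). destruct (In_nth _ _ one Hg') as (j & Hj & <-).
    change (K (copy (E k) (comm (f i) (f j)))). fold m in Hi, Hj.
    destruct (Nat.eq_dec i j) as [->|Hij].
    + replace (comm (f j) (f j)) with (one (G := G)) by (unfold comm; grp).
      rewrite copy_one by apply fin_E. apply HK.
    + pose proof (pos_sum (i + 2) (i + 2) ltac:(lia) ltac:(lia)).
      rewrite <- (conj_copy (E (pos (i + 2))) (E k) (pow a (k + n - pos (i + 2)))); try apply fin_E.
      * apply K_conj; [apply K_pow|]. apply K_comm_copy; assumption.
      * intro x. rewrite pow_a. f_equal. apply E_mod.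
        replace (pos (i + 2) + (k + n - pos (i + 2))) with (k + 1 * n) by lia. apply Nat.Div0.mod_add.
Qed.

(** All copies on the bricks now lie in [K], so they can be stripped off [gen_b] until [link 0] is
    left; powers of [a] translate it. *)
Lemma K_link (k : nat) : K (link k).
Proof.
  assert (H : forall j, K (bprod j) -> K (link 0)).
  { induction j as [|j IH]; intro H; [exact H|]. apply IH. cbn [bprod] in H.
    rewrite <- (mulVK (copy (E (pos (j + 2))) (f j)) (bprod j)).
    destruct HK as (_ & KM & KV). apply KM; [apply KV, K_copy|exact H]. }
  unfold link. rewrite <- (conj_sw (pow a k) (bcat (E 0) (half0 s0)) (bcat (E 1) (half0 s0)));
    try apply fin_EH; try apply link_disj.
  - apply K_conj; [apply K_pow|]. exact (H m Kb).
  - intro u. rewrite <- !Phi_bcat, pow_a. reflexivity.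
  - intro u. rewrite <- !Phi_bcat, pow_a. rewrite Nat.add_comm. reflexivity.
Qed.

(* Conjugation by elements of [K] moves [U] from brick to brick towards [h U],
   until both lie in the same brick. *)
Lemma K_ls_between (d : nat) : d < n -> forall i (h : El G) (U : X -> Prop), movable h U ->
  (forall x, U x -> inb (E i) x) -> (forall x, U x -> inb (E (i + d)) (h x)) ->
  (exists x, inb (E i) x /\ ~ U x) -> (exists x, inb (E (i + d)) x /\ ~ U (inv h x)) ->
  K (ls h U).
Proof.
  induction d as [|d IH]; intros Hd i h U M HU HV (x & Hx & Ux) (y & Hy & Uy).
  (* At distance zero the swap is supported in the single brick [E i], hence is a copy. *)
  - destruct (supp_copy (E i) (ls h U)) as [k ->]; [apply fin_E| |apply K_copy].
    apply (supp_mono _ (fun x => U x \/ U (inv h x))); [|apply ls_supp, M].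
    intros z [Hz|Hz]; [apply HU, Hz|]. rewrite <- (fw_inv h z).
    rewrite Nat.add_0_r in HV. apply HV, Hz.
  - set (j := i + Datatypes.S d) in *.
    assert (Dij : forall z, inb (E i) z -> inb (E j) z -> False).
    { intros z Q Q'. apply (mod_neq i (Datatypes.S d)); [lia|lia|]. exact (E_disj _ _ _ Q Q'). }
    destruct (flexible_in s0 (E i) (half0 s0) U x) as [r Hr]; try assumption;
      [apply fin_E|apply fin_half0|apply M|].
    destruct (flexible_in s0 (E j) (half1 s0) (fun z => U (inv h z)) y) as [q Hq]; try assumption;
      [apply fin_E|apply fin_half1|apply (clopen_pre G HG U (inv h)); [apply fw_lpw|apply M]|].
    (* [r] squeezes [U] into the first half of [E i] and [q] squeezes its image into the second half
       of [E j]; the link then advances [U] by one brick and leaves the image alone, even when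
       [E (i + 1)] is [E j]. *)
    set (g := link i ** copy (E i) r ** copy (E j) q).
    assert (gU : forall z, U z -> inb (bcat (E (i + 1)) (half0 s0)) (g z)).
    { intros z Hz. unfold g. rewrite !mul_fw, (copy_out (E j)).
      - destruct (Hr z Hz (HU z Hz)) as [w ->]. unfold link.
        rewrite sw_l by (try apply fin_EH; apply link_disj). apply inb_Phi.
      - apply fin_E.
      - intro Q. apply (Dij z); auto. }
    assert (gV : forall z, U z -> inb (bcat (E j) (half1 s0)) (g (h z))).
    { intros z Hz. unfold g. rewrite !mul_fw.
      assert (Q : inb (bcat (E j) (half1 s0)) (copy (E j) q (h z))).
      { apply Hq; [rewrite inv_fw; exact Hz|apply HV, Hz]. }
      assert (Qj := inb_bcat_l _ _ _ Q).
      rewrite (copy_out (E i)) by (try apply fin_E; intro R; apply (Dij _ R Qj)).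
      unfold link. rewrite sw_o; try apply fin_EH; [exact Q|apply link_disj| |].
      - intro R. apply inb_bcat_l in R. apply (Dij _ R Qj).
      - intro R. assert (Rj := E_disj _ _ _ (inb_bcat_l _ _ _ R) Qj).
        rewrite (E_mod _ _ Rj) in R. destruct Q as [w Q]. rewrite Q in R.
        rewrite <- Phi_bcat, inb_bcat in R. apply (halves_disj s0 _ R), inb_Phi. }
    assert (Kg : K g).
    { destruct HK as (_ & KM & _). unfold g. repeat apply KM; try apply K_copy. apply K_link. }
    apply (K_conj_iff g); [exact Kg|]. rewrite (conj_ls g h U M).
    apply (IH ltac:(lia) (i + 1)).
    + apply movable_conj, M.
    + intros z Hz. apply (inb_bcat_l _ (half0 s0)). rewrite <- (fw_inv g z). apply gU, Hz.
    + intros z Hz. replace (i + 1 + d) with j by (unfold j; lia).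
      apply (inb_bcat_l _ (half1 s0)). rewrite !mul_fw. apply gV, Hz.
    (* The free points required for the next round come from the halves left empty: the second half
       of [E (i + 1)] and the first half of [E j]. *)
    + exists (Phi (E (i + 1)) (Phi (half1 s0) x)). split; [apply inb_Phi|]. intro Q.
      apply gU in Q. rewrite fw_inv, inb_bcat in Q. apply (halves_disj s0 _ Q), inb_Phi.
    + replace (i + 1 + d) with j by (unfold j; lia).
      exists (Phi (E j) (Phi (half0 s0) x)). split; [apply inb_Phi|]. intro Q.
      apply gV in Q. rewrite !invM, !mul_fw, invK, inv_fw, !fw_inv in Q.
      rewrite inb_bcat in Q. apply (halves_disj s0 (Phi (half0 s0) x)); [apply inb_Phi|exact Q].
Qed.

(** Local swaps generate, and a local swap can be cut, first along [U] and then along its image,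
    until each of the two sets lies in a single piece. *)
Lemma two_generators (h : El G) : K h.
Proof.
  revert h. apply (swaps_generate s0 K HK). intros h U M.
  (* The pieces are halves of the bricks [E k], so that each leaves a point of its brick free, as
     [K_ls_between] demands. *)
  set (piece := fun kb : nat * bool => bcat (E (fst kb)) (single s0 [snd kb])).
  set (L := list_prod (seq 0 n) [true; false]).
  assert (Fp : forall kb, fin_supp (piece kb)).
  { intro kb. apply fin_supp_bcat; [apply fin_E|fs]. }
  assert (Cov : forall x : X, exists kb, In kb L /\ inb (piece kb) x).
  { intro x. destruct (E_cover x) as (k & Hk & [u ->]). destruct (split_bit s0 u) as (c & v & ->).
    exists (k, c). split.
    - apply in_prod; [apply in_seq; lia|destruct c; simpl; auto].
    - unfold piece. simpl. rewrite inb_bcat. apply inb_Phi. }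
  apply (ls_pieces K h (map (fun kb => inb (piece kb)) L) HK); [|exact M| |].
  { intros A HA. apply in_map_iff in HA. destruct HA as (kb & <- & _).
    apply (clopen_brick G HG), Fp. }
  { intros x _. destruct (Cov x) as (kb & Hkb & Hx). exists (inb (piece kb)).
    split; [apply (in_map (fun kb => inb (piece kb))), Hkb|exact Hx]. }
  intros A V HA MV HV. apply in_map_iff in HA. destruct HA as ([i c] & <- & Hi).
  apply (ls_pieces K h (map (fun kb x => inb (piece kb) (h x)) L) HK); [|exact MV| |].
  { intros A HA. apply in_map_iff in HA. destruct HA as (kb & <- & _).
    apply (clopen_pre G HG (inb (piece kb)) h); [apply fw_lpw|]. apply (clopen_brick G HG), Fp. }
  { intros x _. destruct (Cov (h x)) as (kb & Hkb & Hx). exists (fun x => inb (piece kb) (h x)).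
    split; [apply (in_map (fun kb x => inb (piece kb) (h x))), Hkb|exact Hx]. }
  intros A W HA MW HW. apply in_map_iff in HA. destruct HA as ([j c'] & <- & Hj).
  apply in_prod_iff in Hi, Hj. rewrite !in_seq in Hi, Hj.
  (* The cyclic distance from [i] to [j]; subtracting [i] from [n] avoids truncation when [j] is
     smaller than [i]. *)
  assert (Ej : E (i + (j + (n - i)) mod n) = E j).
  { apply E_mod. rewrite Nat.Div0.add_mod_idemp_r.
    replace (i + (j + (n - i))) with (j + 1 * n) by lia. apply Nat.Div0.mod_add. }
  assert (Miss : forall k c, ~ inb (piece (k, c)) (Phi (E k) (Phi (single s0 [negb c]) (fun _ _ => false)))).
  { intros k e Q. unfold piece in Q. simpl in Q. rewrite inb_bcat, inb_single_bit, bit_Phi_single in Q.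
    destruct e; discriminate. }
  apply (K_ls_between ((j + (n - i)) mod n) (mod_lt _) i h W MW).
  - intros x Hx. destruct (HW x Hx) as [Vx _]. destruct (HV x Vx) as [_ Q].
    exact (inb_bcat_l _ _ _ Q).
  - intros x Hx. rewrite Ej. destruct (HW x Hx) as [_ Q]. exact (inb_bcat_l _ _ _ Q).
  - eexists. split; [apply inb_Phi|]. intro Q. destruct (HW _ Q) as [Vx _].
    destruct (HV _ Vx) as [_ R]. exact (Miss i c R).
  - rewrite Ej. eexists. split; [apply inb_Phi|]. intro Q. destruct (HW _ Q) as [_ R].
    rewrite fw_inv in R. exact (Miss j c' R).
Qed.

End TwoGenerators.

(** * Transfer to SV *)

Section Transfer.
Context {S : Type}.
Notation X := (Config S).
Context {G : (S -> S) -> Prop} {HG : perm_group G}.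

Lemma El_SV (e : El G) : SV G e.
Proof. exact (lpw_SV G HG e (inv e) (inv_fw e) (fw_inv e) (fw_lpw e)). Qed.

Lemma SV_El (h : X -> X) : SV G h -> exists e : El G, fw e = h.
Proof.
  intro H. pose proof (SV_lpw G h H) as L. destruct H as [(g & _ & _ & gh & hg) _].
  exists (MkEl h g gh hg L). reflexivity.
Qed.

Lemma Sub_of_subgroup (H : (X -> X) -> Prop) : subgroup_of G H -> Sub (fun e : El G => H e).
Proof.
  intros (_ & H1 & HM & HV). split; [exact H1|]. split.
  - intros f g Hf Hg. exact (HM f g Hf Hg).
  - intros f Hf. exact (HV f (inv f) Hf (inv_fw f) (fw_inv f)).
Qed.

Lemma subgroup_of_Sub (K : El G -> Prop) : Sub K ->
  subgroup_of G (fun h => exists e, fw e = h /\ K e).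
Proof.
  intros (K1 & KM & KV). split; [|split; [|split]].
  - intros h (e & <- & _). apply El_SV.
  - exists one. auto.
  - intros f g (e & <- & He) (e' & <- & He'). exists (e ** e'). auto.
  - intros f finv (e & <- & He) H1 H2. exists (inv e). split; [|auto].
    extensionality x. rewrite <- (H2 x) at 1. apply inv_fw.
Qed.

Lemma SV_is_simple (s0 : S) : SV_simple G.
Proof.
  split.
  - exists (sw (G := G) (half0 s0) (half1 s0)). split; [apply El_SV|].
    intro K. apply (sw_half_neq_one (G := G) s0). apply El_ext. exact K.
  - intros N [HS HJ].
    destruct (classic (exists h, N h /\ ~ is_id h)) as [(h & Nh & Hh)|K].
    + right. intros k Hk. destruct (SV_El h (proj1 HS h Nh)) as [e <-].
      destruct (SV_El k Hk) as [e' <-].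
      apply (El_simple s0 (fun e : El G => N e) e).
      * split; [apply Sub_of_subgroup, HS|]. intros g n Hn.
        exact (HJ g (inv g) n (El_SV g) (inv_fw g) (fw_inv g) Hn).
      * exact Nh.
      * intros ->. apply Hh. intro x. reflexivity.
    + left. intros h Nh. apply NNPP. intro Q. apply K. eauto.
Qed.

Lemma gen_of_generates (L : list (X -> X)) : generates G L ->
  exists l : list (El G), forall h, gen (fun e => In e l) h.
Proof.
  intros [HL Hgen].
  assert (E : exists l : list (El G), map fw l = L).
  { clear Hgen. induction L as [|h L IH]; [exists []; reflexivity|].
    destruct IH as [l Hl]; [intros; apply HL; right; assumption|].
    destruct (SV_El h) as [e He]; [apply HL; left; reflexivity|].
    exists (e :: l). simpl. rewrite He, Hl. reflexivity. }
  destruct E as [l <-]. exists l. intros h K HK Hl.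
  destruct (Hgen h (El_SV h) _ (subgroup_of_Sub K HK)) as (e & Ee & Ke).
  - intros f Hf. apply in_map_iff in Hf. destruct Hf as (e & <- & He). eauto.
  - replace h with e; [exact Ke|]. apply El_ext. intro x. rewrite Ee. reflexivity.
Qed.

Lemma generates_of_El (a b : El G) :
  (forall K : El G -> Prop, Sub K -> K a -> K b -> forall h, K h) -> generates G [fw a; fw b].
Proof.
  intro H. split.
  - intros f [<-|[<-|[]]]; apply El_SV.
  - intros h Hh K HK Hin. destruct (SV_El h Hh) as [e <-].
    apply (H (fun e => K (fw e)) (Sub_of_subgroup K HK)); apply Hin; simpl; auto.
Qed.

(** Repeated halving at [s0] yields exactly the number of bricks that the Sidon construction asks
    for. *)
Lemma power_partition (s0 : S) (k : nat) : exists E : nat -> S -> list bool, brick_partition (2 ^ k) E.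
Proof.
  induction k as [|k [E HE]].
  - exists (fun _ => root). exact brick_partition_root.
  - eexists. rewrite Nat.pow_succ_r'. exact (brick_partition_double _ E s0 HE).
Qed.

Lemma SV_two_generated (s0 : S) : SV_fin_gen G ->
  exists a b, finite_order a /\ finite_order b /\ generates G [a; b].
Proof.
  intros [L HL]. destruct (gen_of_generates L HL) as [l0 Hl0].
  destruct (finitely_many_commutators s0 l0 Hl0) as (l & Hl & Hgen).
  destruct (power_partition s0 (length l + 2)) as [E HE].
  destruct (rotation_exists l E HE) as [a Ha].
  exists (fw a), (fw (gen_b s0 l E)). split; [|split].
  - exists (2 ^ (length l + 2)). split; [pose proof (n_pos l); lia|].
    intro x. rewrite <- pow_iter, (a_order l E HE a Ha). reflexivity.
  - exists 2. split; [lia|]. intro x. simpl. rewrite <- mul_fw, (b_order s0 l Hl E HE). reflexivity.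
  - apply generates_of_El. intros K HK Ka Kb.
    exact (two_generators s0 l Hgen E HE a Ha K HK Ka Kb).
Qed.

End Transfer.

Theorem theorem3p4 (S : Type) (HS : inhabited S) (G : (S -> S) -> Prop)
  (HG : perm_group G) :
  SV_simple G /\
  (SV_fin_gen G ->
     exists a b, finite_order a /\ finite_order b /\ generates G [a; b]).
Proof.
  destruct HS as [s0]. split.
  - exact (SV_is_simple s0).
  - exact (SV_two_generated s0).
Qed.
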